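(* Let $(\Omega,\mu)$ be a non-atomic probability space and let $1\le p,q<\infty$. Let $M_{p,q}:S_{L_p(\Omega,\mu,\mathbb C)}\to S_{L_q(\Omega,\mu,\mathbb C)}$ be the Mazur map $M_{p,q}(f)=|f|^{p/q}\operatorname{sign}(f)$. Then the following (Mazur) estimates for $M_{p,q}$ are all sharp: (i) if $1\le q<p<\infty$, then $\omega_{M_{p,q}}(t)\le \frac pq\,t$ and $\rho_{M_{p,q}}(t)\ge 2^{1-\frac pq}t^{\frac pq}$ for $0\le t\le 2$; (ii) if $1\le p\le q<\infty$, then $\omega_{M_{p,q}}(t)\le 2^{1-\frac pq}t^{\frac pq}$ and $\rho_{M_{p,q}}(t)\ge\frac pq\,t$ for $0\le t\le 2$. Here an upper estimate $\omega_{M_{p,q}}(t)\le Ct^{\gamma}$ ($0\le t\le2$) is called sharp if $C$ is the least constant for which it holds with exponent $\gamma$, and for no $\gamma'>\gamma$ and $C'<\infty$ does $\omega_{M_{p,q}}(t)\le C't^{\gamma'}$ hold for all $0\le t\le 2$; a lower estimate $\rho_{M_{p,q}}(t)\ge ct^{\gamma}$ ($0\le t\le2$) is called sharp if $c$ is the largest constant for which it holds with exponent $\gamma$, and for no $\gamma'<\gamma$ and $c'>0$ does $\rho_{M_{p,q}}(t)\ge c't^{\gamma'}$ hold for all $0\le t\le 2$.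
   Context: $S_X$ is the unit sphere of a Banach space $X$ with the metric $d(x,y)=\|x-y\|_X$; $L_p(\Omega,\mu,\mathbb C)$ is the space of complex-valued $p$-integrable functions. For $z\in\mathbb C$, $\operatorname{sign}(z)=z/|z|$ if $z\ne0$ and $\operatorname{sign}(0)=0$, applied pointwise. For a map $f:(\mathcal M,d_{\mathcal M})\to(\mathcal N,d_{\mathcal N})$ between metric spaces, $\omega_f(t)=\sup\{d_{\mathcal N}(f(x),f(y)): d_{\mathcal M}(x,y)\le t\}$ and $\rho_f(t)=\inf\{d_{\mathcal N}(f(x),f(y)): d_{\mathcal M}(x,y)\ge t\}$. *)

(* Defs.v *)
From HB Require Import structures.
From mathcomp Require Import all_boot all_order all_algebra.
From mathcomp Require Import generic_quotient ring_quotient.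
From mathcomp Require Import complex.
From mathcomp Require Import all_classical all_reals all_analysis measurable_realfun.

Set Implicit Arguments.
Unset Strict Implicit.
Unset Printing Implicit Defensive.

Import Order.TTheory GRing.Theory Num.Theory.
Import numFieldNormedType.Exports.

Local Open Scope classical_set_scope.
Local Open Scope ring_scope.

Section moduli.
Context {R : realType} {M N : metricType R}.
Implicit Types (f : M -> N) (t : R).

(* Extended-real valued; the infimum over the empty set is [+oo]. *)
Definition omega f t : \bar R :=
  ereal_sup [set (mdist (f z.1) (f z.2))%:E |
             z in [set z : M * M | mdist z.1 z.2 <= t]].

Definition rho f t : \bar R :=
  ereal_inf [set (mdist (f z.1) (f z.2))%:E |
             z in [set z : M * M | t <= mdist z.1 z.2]].

End moduli.

Section sharpness.
Context {R : realType}.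
Implicit Types (w : R -> \bar R) (c g : R).

Definition upper_estimate w c g : Prop :=
  forall t, 0 <= t <= 2 -> (w t <= (c * t `^ g)%:E)%E.

Definition lower_estimate w c g : Prop :=
  forall t, 0 <= t <= 2 -> ((c * t `^ g)%:E <= w t)%E.

Definition sharp_upper_estimate w c g : Prop :=
  [/\ upper_estimate w c g,
      forall c', upper_estimate w c' g -> c <= c' &
      forall g' c', g < g' -> ~ upper_estimate w c' g'].

Definition sharp_lower_estimate w c g : Prop :=
  [/\ lower_estimate w c g,
      forall c', lower_estimate w c' g -> c' <= c &
      forall g' c', g' < g -> 0 < c' -> ~ lower_estimate w c' g'].

End sharpness.

Section unit_sphere.
Context {R : realType} (X : normedZmodType R).

Definition unit_sphere : Type := {x : X | `|x| == 1}.

HB.instance Definition _ := Choice.on unit_sphere.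

Let dist (x y : unit_sphere) : R := `|val x - val y|.

Let distxx x : dist x x = 0.
Proof. by rewrite /dist subrr normr0. Qed.

Let dist_positivity x y : dist x y = 0 -> x = y.
Proof. by move/normr0_eq0/eqP; rewrite subr_eq0 => /eqP/val_inj. Qed.

Let dist_sym x y : dist x y = dist y x.
Proof. exact: distrC. Qed.

Let dist_triangle y x z : dist x z <= dist x y + dist y z.
Proof. exact: ler_distD. Qed.

HB.instance Definition _ :=
  isMetric.Build R unit_sphere distxx dist_positivity dist_sym dist_triangle.

Lemma unit_sphere_mdistE (x y : unit_sphere) :
  mdist x y = `|val x - val y|.
Proof. by []. Qed.

End unit_sphere.

(* Complex numbers are taken in [Rcomplex R], which is R[i] with the R-valued
   modulus [`|z|] and the scaling [k *: z] by real numbers.  [Re] and [Im] are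
   qualified because ssrnum uses the same names for its C-valued operators. *)
Section cmeasurable.
Context d (T : measurableType d) (R : realType).
Implicit Types f g : T -> Rcomplex R.

(* Equivalent to Borel measurability, C being homeomorphic to R x R. *)
Definition cmeasurable f : Prop :=
  measurable_fun setT (fun x => complex.Re (f x)) /\
  measurable_fun setT (fun x => complex.Im (f x)).

Lemma Rcomplex_normE (z : Rcomplex R) :
  `|z| = Num.sqrt (complex.Re z ^+ 2 + complex.Im z ^+ 2).
Proof. by case: z. Qed.

Lemma cmeasurable_norm f :
  cmeasurable f -> measurable_fun setT (fun x => `|f x| : R).
Proof.
move=> [mr mi].
rewrite (_ : (fun x => _) = fun x => Num.sqrt (complex.Re (f x) ^+ 2 + complex.Im (f x) ^+ 2)); last first.
  by apply/funext => x; rewrite Rcomplex_normE.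
apply: (measurableT_comp (f := @Num.sqrt R)).
  by apply: continuous_measurable_fun; exact: sqrt_continuous.
by apply: measurable_funD; apply: measurable_funX.
Qed.

Lemma cmeasurable0 : cmeasurable (0 : T -> Rcomplex R).
Proof. by split; exact: measurable_cst. Qed.

Lemma cmeasurableD f g : cmeasurable f -> cmeasurable g -> cmeasurable (f + g).
Proof.
move=> [mfr mfi] [mgr mgi]; split.
  rewrite (_ : (fun x => _) = (fun x => complex.Re (f x)) \+ (fun x => complex.Re (g x))).
    exact: measurable_funD.
  by apply/funext => x /=; rewrite fctE; case: (f x) (g x) => [? ?] [? ?].
rewrite (_ : (fun x => _) = (fun x => complex.Im (f x)) \+ (fun x => complex.Im (g x))).
  exact: measurable_funD.
by apply/funext => x /=; rewrite fctE; case: (f x) (g x) => [? ?] [? ?].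
Qed.

Lemma cmeasurableN f : cmeasurable f -> cmeasurable (- f).
Proof.
move=> [mfr mfi]; split.
  rewrite (_ : (fun x => _) = \- (fun x => complex.Re (f x))).
    exact: measurable_funN.
  by apply/funext => x /=; rewrite fctE; case: (f x).
rewrite (_ : (fun x => _) = \- (fun x => complex.Im (f x))).
  exact: measurable_funN.
by apply/funext => x /=; rewrite fctE; case: (f x).
Qed.

End cmeasurable.

Section cLnorm.
Context d (T : measurableType d) (R : realType).
Variables (mu : {measure set T -> \bar R}) (p : R).
Hypothesis p1 : 1 <= p.
Implicit Types f g : T -> Rcomplex R.

Definition cLnorm f : \bar R := Lnorm mu p%:E (fun x => `|f x|%:E).

Let p0 : 0 < p. Proof. exact: lt_le_trans p1. Qed.

Let integrand f x : (`| `|f x|%:E | `^ p)%E = (`|f x| `^ p)%:E.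
Proof. by rewrite gee0_abs ?lee_fin. Qed.

Let minteg f : cmeasurable f -> measurable_fun setT (fun x => (`|f x| `^ p)%:E).
Proof.
move=> mf; apply/measurable_EFinP.
exact: (measurableT_comp (measurable_powR p) (cmeasurable_norm mf)).
Qed.

Lemma cLnormE f : cLnorm f = ((\int[mu]_x (`|f x| `^ p)%:E) `^ p^-1)%E.
Proof.
by rewrite /cLnorm unlock; congr poweR; apply: eq_integral => x _; rewrite integrand.
Qed.

Lemma cLnorm_ge0 f : (0 <= cLnorm f)%E.
Proof. exact: Lnorm_ge0. Qed.

Lemma ae_eq_cLnorm f g : cmeasurable f -> cmeasurable g ->
  f = g %[ae mu] -> cLnorm f = cLnorm g.
Proof.
move=> mf mg fg; rewrite !cLnormE; congr poweR.
apply: ae_eq_integral => //; [exact: minteg|exact: minteg|].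
by apply: filterS fg => x /= + _ => /(_ I) ->.
Qed.

Lemma cLnorm0 : cLnorm 0 = 0%E.
Proof.
rewrite /cLnorm (_ : (fun x => _) = cst 0%E) ?Lnorm0 ?gt_eqF//.
by apply/funext => x /=; rewrite normr0.
Qed.

Lemma cLnormN f : cLnorm (- f) = cLnorm f.
Proof. by apply: eq_Lnorm => x /=; rewrite fctE normrN. Qed.

Lemma cLnormMn f n : cmeasurable f -> cLnorm (f *+ n) = (n%:R%:E * cLnorm f)%E.
Proof.
move=> mf; rewrite !cLnormE.
under eq_integral.
  move=> x _.
  rewrite (_ : (f *+ n) x = f x *+ n); last first.
    elim: n => // n IH; first by rewrite !mulrS fctE IH.
  rewrite normrMn -mulr_natl powRM// EFinM.
  over.
rewrite ge0_integralZl ?lee_fin ?powR_ge0//; last exact: minteg.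
rewrite poweRM ?lee_fin ?powR_ge0//; last first.
  by apply: integral_ge0 => x _; rewrite lee_fin powR_ge0.
by rewrite poweR_EFin -powRrM mulfV ?gt_eqF// powRr1.
Qed.

Lemma cLnormD f g : cmeasurable f -> cmeasurable g ->
  (cLnorm (f + g)%R <= cLnorm f + cLnorm g)%E.
Proof.
move=> mf mg.
have mnf := cmeasurable_norm mf; have mng := cmeasurable_norm mg.
apply: (@le_trans _ _ (Lnorm mu p%:E (EFin \o ((fun x => `|f x| : R) \+ (fun x => `|g x| : R))))); last first.
  exact: minkowski_EFin.
rewrite cLnormE unlock.
rewrite [X in (_ <= X `^ _)%E](_ : _ = (\int[mu]_x ((`|f x| + `|g x|) `^ p)%:E)%E) //; last first.
  by apply: eq_integral => x _ /=; rewrite ger0_norm// addr_ge0.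
apply: gt0_ler_poweR.
- by rewrite invr_ge0 ltW.
- by rewrite in_itv/= leey andbT integral_ge0// => x _; rewrite lee_fin powR_ge0.
- by rewrite in_itv/= leey andbT integral_ge0// => x _; rewrite lee_fin powR_ge0.
apply: ge0_le_integral => //.
- exact/minteg/cmeasurableD.
- apply/measurable_EFinP.
  apply: (measurableT_comp (measurable_powR p)) => //=.
  exact: measurable_funD.
- move=> x _; rewrite lee_fin ge0_ler_powR// ?nnegrE ?addr_ge0//; [exact: ltW|].
  exact: ler_normD.
Qed.

Lemma cLnorm_eq0 f : cmeasurable f -> cLnorm f = 0%E -> f = 0 %[ae mu].
Proof.
move=> mf f0.
have mnf : measurable_fun setT (fun x => `|f x|%:E).
  exact/measurable_EFinP/cmeasurable_norm.
have : (fun x => `|f x|%:E) = \0%E %[ae mu] by apply: Lnorm_eq0_eq0 f0.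
by apply: filterS => x /= /(_ I) [] /eqP + _; rewrite normr_eq0 => /eqP.
Qed.

End cLnorm.

Section cLspace.
Context d (T : measurableType d) (R : realType).
Variables (mu : {measure set T -> \bar R}) (p : R) (p1 : 1 <= p).

(* The proof of [1 <= p] is an index so that the closure properties below can be
   inferred by canonical structures. *)
Definition cLfun of 1 <= p : {pred T -> Rcomplex R} :=
  fun f => `[< cmeasurable f /\ (cLnorm mu p f < +oo)%E >].

Lemma cLfun_zmod_closed : zmod_closed (cLfun p1).
Proof.
split=> [|f g].
  apply/asboolP; split; first exact: cmeasurable0.
  by rewrite cLnorm0// ltry.
move=> /asboolP[mf foo] /asboolP[mg goo]; apply/asboolP.
split; first exact/cmeasurableD/cmeasurableN.
apply: le_lt_trans (cLnormD mu p1 mf (cmeasurableN mg)) _.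
by rewrite cLnormN lte_add_pinfty.
Qed.

HB.instance Definition _ :=
  GRing.isZmodClosed.Build (T -> Rcomplex R) (cLfun p1) cLfun_zmod_closed.

Definition cLfunType : Type := {f : T -> Rcomplex R | f \in cLfun p1}.

HB.instance Definition _ := SubChoice.on cLfunType.
HB.instance Definition _ := [SubChoice_isSubZmodule of cLfunType by <:].

Lemma cLfunP (f : cLfunType) :
  cmeasurable (val f) /\ (cLnorm mu p (val f) < +oo)%E.
Proof. exact/asboolP/(valP f). Qed.

Definition ae_zero : {pred cLfunType} :=
  fun f => `[< val f = 0 %[ae mu] >].

Lemma ae_zero_zmod_closed : zmod_closed ae_zero.
Proof.
split=> [|f g]; first by apply/asboolP/aeW => x _; rewrite raddf0.
move=> /asboolP f0 /asboolP g0; apply/asboolP.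
apply: filterS2 f0 g0 => x f0 g0 xT.
have -> : val (f - g) = val f - val g by exact: raddfB.
by rewrite -[LHS]/(val f x - val g x) f0// g0// subrr.
Qed.

HB.instance Definition _ :=
  GRing.isZmodClosed.Build cLfunType ae_zero ae_zero_zmod_closed.

Definition cLspace : Type := Quotient.quot ae_zero.

HB.instance Definition _ := Choice.on cLspace.
HB.instance Definition _ := GRing.Zmodule.on cLspace.
HB.instance Definition _ :=
  ZmodQuotient.on cLspace.

Local Open Scope quotient_scope.

Lemma cLspace_eqP (f g : cLfunType) :
  (\pi_cLspace f = \pi_cLspace g) <-> (val f = val g %[ae mu]).
Proof.
have E : val (f - g) = val f - val g by exact: raddfB.
split=> [/eqmodP|fg]; last apply/eqmodP.
  rewrite /= /Quotient.equiv => /asboolP; rewrite E; apply: filterS => x + xT.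
  by move=> /(_ xT)/eqP; rewrite -[X in X == _]/(val f x - val g x) subr_eq0 => /eqP.
rewrite /= /Quotient.equiv; apply/asboolP; rewrite E; apply: filterS fg => x + xT.
by move=> /(_ xT) fg; rewrite -[LHS]/(val f x - val g x) fg subrr.
Qed.

Definition cLspace_norm (f : cLspace) : R := fine (cLnorm mu p (val (repr f))).

Lemma cLspace_norm_pi (f : cLfunType) :
  (cLspace_norm (\pi_cLspace f))%:E = cLnorm mu p (val f).
Proof.
rewrite /cLspace_norm.
have [mf foo] := cLfunP f.
rewrite (ae_eq_cLnorm _ (cLfunP (repr (\pi_cLspace f))).1 mf); last first.
  by apply/cLspace_eqP; rewrite reprK.
by rewrite fineK// ge0_fin_numE// cLnorm_ge0.
Qed.

Let norm := cLspace_norm.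

Let normD f g : norm (f + g) <= norm f + norm g.
Proof.
rewrite -[f]reprK -[g]reprK -raddfD -lee_fin EFinD !cLspace_norm_pi.
have -> : val (repr f + repr g) = val (repr f) + val (repr g) by exact: raddfD.
by apply: cLnormD => //; exact: (cLfunP _).1.
Qed.

Let norm_eq0 f : norm f = 0 -> f = 0.
Proof.
move=> nf0; have : (norm f)%:E = 0%E by rewrite nf0.
rewrite -[f]reprK cLspace_norm_pi => f0.
rewrite -(raddf0 \pi_cLspace); apply: (iffRL (cLspace_eqP _ _)).
exact: (cLnorm_eq0 p1 (cLfunP _).1 f0).
Qed.

Let normMn f n : norm (f *+ n) = norm f *+ n.
Proof.
apply: EFin_inj; rewrite -[f]reprK -raddfMn cLspace_norm_pi.
have -> : val (repr f *+ n) = val (repr f) *+ n by exact: raddfMn.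
rewrite cLnormMn//; last exact: (cLfunP _).1.
by rewrite -[in RHS]mulr_natl EFinM cLspace_norm_pi.
Qed.

Let normN f : norm (- f) = norm f.
Proof.
apply: EFin_inj; rewrite -[f]reprK -raddfN !cLspace_norm_pi.
have -> : val (- repr f) = - val (repr f) by exact: raddfN.
exact: cLnormN.
Qed.

HB.instance Definition _ :=
  Num.Zmodule_isNormed.Build R cLspace normD norm_eq0 normMn normN.

Lemma cLspace_normE (f : cLfunType) :
  `|\pi_cLspace f|%:E = cLnorm mu p (val f).
Proof. exact: cLspace_norm_pi. Qed.

End cLspace.

Section mazur_fun.
Context {R : realType}.
Implicit Types (z : Rcomplex R) (a : R).

Definition csign z : Rcomplex R := if z == 0 then 0 else `|z|^-1 *: z.

Definition cmazur a z : Rcomplex R := `|z| `^ a *: csign z.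

Lemma Rcomplex_normZ (k : R) z : `|k *: z| = `|k| * `|z|.
Proof.
rewrite !Rcomplex_normE; case: z => x y /=.
by rewrite !exprMn -mulrDr sqrtrM ?sqr_ge0// sqrtr_sqr.
Qed.

Lemma cmazurE a z : cmazur a z = `|z| `^ (a - 1) *: z.
Proof.
rewrite /cmazur /csign; have [->|z0] := eqVneq z 0; first by rewrite !scaler0.
rewrite scalerA powRD; last by rewrite normr_eq0 z0 implybT.
by rewrite powRN powRr1.
Qed.

Lemma norm_cmazur a z : 0 < a -> `|cmazur a z| = `|z| `^ a.
Proof.
move=> a0; have [->|z0] := eqVneq z 0.
  by rewrite cmazurE scaler0 normr0 powR0// gt_eqF.
rewrite /cmazur /csign (negPf z0) !Rcomplex_normZ ger0_norm ?powR_ge0//.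
by rewrite ger0_norm ?invr_ge0// mulVf ?mulr1// normr_eq0.
Qed.

Lemma cmeasurable_cmazur d (T : measurableType d) a (f : T -> Rcomplex R) :
  cmeasurable f -> cmeasurable (fun x => cmazur a (f x)).
Proof.
move=> mf; have mp : measurable_fun setT (fun x => `|f x| `^ (a - 1)).
  exact: (measurableT_comp (measurable_powR _) (cmeasurable_norm mf)).
have [mr mi] := mf; split.
  rewrite (_ : (fun x => _) = (fun x => `|f x| `^ (a - 1)) \* (fun x => complex.Re (f x))).
    exact: measurable_funM.
  by apply/funext => x /=; rewrite cmazurE; case: (f x).
rewrite (_ : (fun x => _) = (fun x => `|f x| `^ (a - 1)) \* (fun x => complex.Im (f x))).
  exact: measurable_funM.
by apply/funext => x /=; rewrite cmazurE; case: (f x).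
Qed.

End mazur_fun.

Section mazur.
Context d (T : measurableType d) (R : realType).
Variables (mu : {measure set T -> \bar R}) (p q : R) (p1 : 1 <= p) (q1 : 1 <= q).

Lemma cLnorm_cmazur (f : T -> Rcomplex R) :
  (cLnorm mu q (fun x => cmazur (p / q) (f x)) = cLnorm mu p f `^ (p / q))%E.
Proof.
have p0 : 0 < p by exact: lt_le_trans p1.
have q0 : 0 < q by exact: lt_le_trans q1.
rewrite !cLnormE -[RHS]poweRrM mulrA mulVf ?gt_eqF// mul1r; congr poweR.
apply: eq_integral => x _.
by rewrite norm_cmazur ?divr_gt0// -powRrM divfK ?gt_eqF.
Qed.

Lemma cmazur_cLfun (f : cLfunType mu p1) :
  (fun x => cmazur (p / q) (val f x)) \in cLfun mu q1.
Proof.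
have [mf foo] := cLfunP f; apply/asboolP; split.
  exact: cmeasurable_cmazur.
by rewrite cLnorm_cmazur poweR_lty.
Qed.

Definition mazurLfun (f : cLfunType mu p1) : cLfunType mu q1 :=
  Sub (fun x => cmazur (p / q) (val f x)) (cmazur_cLfun f).

Lemma val_mazurLfun (f : cLfunType mu p1) :
  val (mazurLfun f) = fun x => cmazur (p / q) (val f x).
Proof. exact: SubK. Qed.

Local Open Scope quotient_scope.

(* [mazurLspace_pi] shows independence of the chosen representative. *)
Definition mazurLspace (f : cLspace mu p1) : cLspace mu q1 :=
  \pi_(cLspace mu q1) (mazurLfun (repr f)).

Lemma mazurLspace_pi (f : cLfunType mu p1) :
  mazurLspace (\pi_(cLspace mu p1) f) = \pi_(cLspace mu q1) (mazurLfun f).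
Proof.
apply: (iffRL (cLspace_eqP _ _)); rewrite !val_mazurLfun.
have : val (repr (\pi_(cLspace mu p1) f)) = val f %[ae mu].
  by apply: (iffLR (cLspace_eqP _ _)); rewrite reprK.
by apply: filterS => x + xT => /(_ xT) ->.
Qed.

Lemma mazurLspace_sphere (f : unit_sphere (cLspace mu p1)) :
  `|mazurLspace (val f)| == 1.
Proof.
have /eqP f1 := valP f.
rewrite -eqe cLspace_normE val_mazurLfun cLnorm_cmazur -cLspace_normE reprK f1.
by rewrite poweR_EFin powR1.
Qed.

Definition mazur (f : unit_sphere (cLspace mu p1)) :
    unit_sphere (cLspace mu q1) :=
  Sub (mazurLspace (val f)) (mazurLspace_sphere f).

End mazur.

Arguments mazur {d T R} mu {p q} p1 q1 f.

Definition non_atomic d (T : measurableType d) (R : realType)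
    (mu : {measure set T -> \bar R}) : Prop :=
  forall A, measurable A -> (0 < mu A)%E ->
    exists B, [/\ measurable B, B `<=` A, (0 < mu B)%E & (mu B < mu A)%E].

(* Main.v *)
Require Import Defs.
From mathcomp Require Import all_boot all_order all_algebra.
From mathcomp Require Import complex.
From mathcomp Require Import all_classical all_reals all_analysis.
From mathcomp Require Import measurable_realfun ring lra.

Import Order.TTheory GRing.Theory Num.Theory.
Import numFieldNormedType.Exports.
Local Open Scope ring_scope.

(** Write a = p/q, so that the Mazur map acts pointwise by
    z |-> |z|^(a-1) z on representatives ([cmazurE]).

    Two upper bounds carry the proof.  If p <= q, then a <= 1 and the pointwise
    map is a-Hoelder on the complex plane with constant 2^(1-a)
    ([cmazur_hoelder]); raising to the power q and integrating gives the same
    estimate for the norms ([cLnorm_cmazur_hoelder]).  If q <= p, then the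
    pointwise map is not globally Lipschitz, but its derivative at z has size
    at most a |z|^(a-1); integrating this along the segment from g to f and
    using Hoelder's inequality with exponents p/q and p/(p-q) bounds
    ||M f - M g||_q by a ||f - g||_p times the supremum of the (a-1)-st power
    of the L_p-norm over the segment, and that is at most 1 because the segment
    lies in the unit ball ([cLnorm_cmazur_lipschitz]).

    The maps M_{p,q} and M_{q,p} are inverse to each other ([mazurK]), so the
    upper bounds for M_{q,p} are the lower bounds for M_{p,q}.

    All optimality claims are witnessed by real functions taking one value on a
    set A of measure 1/2 and another on its complement.  Such an A exists
    because the measure is non-atomic ([non_atomic_measure_eq]).
    - The constant functions 1 and -1 are at distance 2, and so are their
      images: this forces the constant 2^(1-a).
    - The functions s 1_A + r 1_{A^c} and -s 1_A + r 1_{A^c} are at distance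
      proportional to s, and their images at distance proportional to s^a: as
      s -> 0, this forces the exponent a ([exists_flip_pair]).
    - The functions u 1_A + v 1_{A^c} and v 1_A + u 1_{A^c} are at distance
      u - v, and their images at distance u^a - v^a: as u, v -> 1, the ratio
      tends to a, which forces both the constant a and the exponent 1
      ([exists_swap_pair]). *)

(** * Inequalities for real powers *)

Section real_power.
Set Implicit Arguments.
Unset Strict Implicit.
Context {R : realType}.
Implicit Types a l u v x y : R.

(** A two-sided substitute for the mean value theorem: exchanging [u] and [v]
    bounds the same difference from below.  With x = v/u it reads
    1 - x^a <= a (1/x - 1), which follows from 1 + t <= exp t applied to
    t = a ln x and to t = - ln x. *)
Lemma powR_diff_le a u v : 0 <= a -> 0 < u -> 0 < v ->
  u `^ a - v `^ a <= a * (u - v) * (u `^ a / v).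
Proof.
move=> a0 u0 v0.
have ln_le x : 0 < x -> ln x <= x - 1.
  move=> x0; have := @le_ln1Dx R (x - 1).
  by rewrite addrCA subrr addr0; apply; lra.
have x0 : 0 < v / u by rewrite divr_gt0.
have key : 1 - (v / u) `^ a <= a * (u / v - 1).
  have h1 : 1 + a * ln (v / u) <= (v / u) `^ a.
    by rewrite /powR gt_eqF// expR_ge1Dx.
  have h2 : - ln (v / u) <= u / v - 1.
    by rewrite -lnV ?posrE// invf_div ln_le// divr_gt0.
  have := ler_wpM2l a0 h2; lra.
have -> : v `^ a = u `^ a * (v / u) `^ a.
  rewrite -powRM; [|lra|lra]; congr (_ `^ _); field; lra.
have -> : a * (u - v) * (u `^ a / v) = u `^ a * (a * (u / v - 1)) by field; lra.
by have := ler_wpM2l (powR_ge0 u a) key; rewrite mulrBr mulr1.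
Qed.

(** Since t <= t^a on [0, 1], x^a and y^a are at least the proportions
    x/(x+y) and y/(x+y) of (x+y)^a. *)
Lemma powR_subadditive a x y : 0 < a <= 1 -> 0 <= x -> 0 <= y ->
  (x + y) `^ a <= x `^ a + y `^ a.
Proof.
move=> /andP[a0 a1] x0 y0.
have [xy0|xy0] := eqVneq (x + y) 0.
  by rewrite xy0 powR0 ?gt_eqF// addr_ge0 ?powR_ge0.
have s0 : 0 < x + y by lra.
have frac z : 0 <= z -> z <= x + y -> z / (x + y) * (x + y) `^ a <= z `^ a.
  move=> z0 zs; have [->|zn] := eqVneq z 0.
    by rewrite !mul0r powR_ge0.
  have -> : z `^ a = (z / (x + y)) `^ a * (x + y) `^ a.
    rewrite -powRM; [|by rewrite divr_ge0//; lra|lra].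
    by rewrite divfK.
  rewrite ler_wpM2r ?powR_ge0// ger1_powR// divr_gt0 ?ler_pdivrMr//=; lra.
have := lerD (frac x x0 _) (frac y y0 _).
rewrite -mulrDl -mulrDl divff// mul1r; apply; lra.
Qed.

(** Convexity of the inverse function x |-> x^(1/a). *)
Lemma powR_concave a l x y : 0 < a <= 1 -> 0 <= l <= 1 -> 0 <= x -> 0 <= y ->
  l * x `^ a + (1 - l) * y `^ a <= (l * x + (1 - l) * y) `^ a.
Proof.
move=> /andP[a0 a1] /andP[l0 l1] x0 y0.
have b1 : 1 <= a^-1 by rewrite invf_ge1.
pose t := Itv01 l0 l1.
have := convex_powR b1 t (x := x `^ a) (y := y `^ a).
rewrite !inE /= !in_itv/= !andbT !powR_ge0 => /(_ isT isT).
rewrite !convRE /= -!powRrM mulfV ?gt_eqF// !powRr1// => h.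
set L := l * x `^ a + _ in h *.
have L0 : 0 <= L by rewrite /L addr_ge0// mulr_ge0 ?powR_ge0//; lra.
have -> : L = (L `^ a^-1) `^ a by rewrite -powRrM mulVf ?gt_eqF// powRr1.
by apply: ge0_ler_powR; rewrite ?nnegrE ?powR_ge0 ?addr_ge0 ?mulr_ge0//; lra.
Qed.

Lemma powR_sum_le a x y : 0 < a <= 1 -> 0 <= x -> 0 <= y ->
  x `^ a + y `^ a <= 2 `^ (1 - a) * (x + y) `^ a.
Proof.
move=> a01 x0 y0; have /andP[a0 a1] := a01.
have := @powR_concave a 2^-1 x y a01 _ x0 y0.
have -> : 0 <= (2^-1 : R) <= 1 by apply/andP; split; lra.
move=> /(_ isT).
have -> : 2^-1 * x + (1 - 2^-1) * y = (x + y) * 2^-1 by lra.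
rewrite powRM; [|lra|lra].
have -> : (2^-1 : R) `^ a = (2 `^ a)^-1.
  by rewrite -powR_inv1// powRAC powR_inv1// powR_ge0.
have -> : (2 : R) `^ (1 - a) = 2 / 2 `^ a.
  by rewrite powRB ?powRr1// pnatr_eq0 implybT.
have : 0 < (2 : R) `^ a by rewrite powR_gt0.
set T := 2 `^ a; set S := (_ + _) `^ a; move=> T0 h.
have -> : 2 / T * S = 2 * (S * T^-1) by ring.
lra.
Qed.

End real_power.

(** * The pointwise Mazur map *)

Section pointwise.
Set Implicit Arguments.
Unset Strict Implicit.
Context {R : realType}.
Implicit Types (a b k l : R) (z w : Rcomplex R).

(** The law of cosines, with the inner product of [z] and [w] eliminated in
    favour of their distance. *)
Lemma sqr_norm_scaleB k l z w :
  `|k *: z - l *: w| ^+ 2 = (k * `|z|) ^+ 2 + (l * `|w|) ^+ 2 +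
    k * l * (`|z - w| ^+ 2 - `|z| ^+ 2 - `|w| ^+ 2).
Proof.
have E u : `|u : Rcomplex R| ^+ 2 = complex.Re u ^+ 2 + complex.Im u ^+ 2.
  by rewrite Rcomplex_normE sqr_sqrtr// addr_ge0 ?sqr_ge0.
rewrite !exprMn !E; case: z w => [x y] [x' y'] /=.
ring.
Qed.

(** Fix the moduli r and s of [z] and [w] and let the angle vary.  The squared
    distance is t (r-s)^2 + (1-t) (r+s)^2 for some t in [0, 1], and by the law
    of cosines the squared distance of the images is the combination of
    (r^a-s^a)^2 and (r^a+s^a)^2 with the same t.  As x |-> x^a is concave, it
    suffices to treat the collinear cases t = 0 and t = 1, where the claim is
    concavity and subadditivity of x |-> x^a. *)
Lemma cmazur_hoelder a z w : 0 < a <= 1 ->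
  `|cmazur a z - cmazur a w| <= 2 `^ (1 - a) * `|z - w| `^ a.
Proof.
move=> a01; have /andP[a0 a1] := a01.
have K1 : 1 <= (2 : R) `^ (1 - a).
  have := @ler_powR R 2 ltac:(lra) 0 (1 - a); rewrite powRr0; apply; lra.
set K := 2 `^ (1 - a) in K1 *.
have M0 : cmazur a (0 : Rcomplex R) = 0 by rewrite cmazurE scaler0.
have [->|z0] := eqVneq z 0.
  by rewrite M0 !sub0r !normrN norm_cmazur// ler_peMl ?powR_ge0.
have [->|w0] := eqVneq w 0.
  by rewrite M0 !subr0 norm_cmazur// ler_peMl ?powR_ge0.
have r0 : 0 < `|z| by rewrite normr_gt0.
have s0 : 0 < `|w| by rewrite normr_gt0.
have Dlo : `| `|z| - `|w| | <= `|z - w| by exact: ler_dist_dist.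
have Dhi : `|z - w| <= `|z| + `|w| by exact: ler_normB.
have D0 : 0 <= `|z - w| by [].
rewrite -ler_sqr ?nnegrE ?mulr_ge0 ?powR_ge0//.
rewrite !cmazurE sqr_norm_scaleB.
rewrite ![_ `^ (a - 1) * `|_|]mulrC !mulr_powRB1//.
have prodE : `|z| `^ (a - 1) * `|w| `^ (a - 1) * (`|z| * `|w|)
    = `|z| `^ a * `|w| `^ a.
  by rewrite mulrACA ![_ `^ (a - 1) * `|_|]mulrC !mulr_powRB1.
set k := _ `^ (a - 1) in prodE *; set l := _ `^ (a - 1) in prodE *.
move: (`|z|) (`|w|) (`|z - w|) r0 s0 Dlo Dhi D0 @k @l prodE => r s D.
move=> r0 s0 Dlo Dhi D0 k l; move: k l => k l kl.
(* The solution t of D^2 = t (r-s)^2 + (1-t) (r+s)^2. *)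
pose t := ((r + s) ^+ 2 - D ^+ 2) / (4 * (r * s)).
have rs0 : 0 < r * s by rewrite mulr_gt0.
have Dlo2 : (r - s) ^+ 2 <= D ^+ 2.
  by rewrite -[leLHS]real_normK ?num_real// ler_sqr ?nnegrE.
have Dhi2 : D ^+ 2 <= (r + s) ^+ 2 by rewrite ler_sqr ?nnegrE; lra.
have t01 : 0 <= t <= 1.
  apply/andP; split; first by rewrite divr_ge0//; lra.
  by rewrite ler_pdivrMr; nra.
have DE : D ^+ 2 = t * (r - s) ^+ 2 + (1 - t) * (r + s) ^+ 2.
  by rewrite /t; field; lra.
have -> : (r `^ a) ^+ 2 + (s `^ a) ^+ 2 + k * l * (D ^+ 2 - r ^+ 2 - s ^+ 2)
   = t * (r `^ a - s `^ a) ^+ 2 + (1 - t) * (r `^ a + s `^ a) ^+ 2.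
  rewrite DE.
  transitivity ((r `^ a) ^+ 2 + (s `^ a) ^+ 2 + k * l * (r * s) * (2 - 4 * t)).
    ring.
  rewrite kl; ring.
have sqrE x : 0 <= x -> (x `^ a) ^+ 2 = (x ^+ 2) `^ a.
  by move=> x0; rewrite !expr2 powRM.
have lo : (r `^ a - s `^ a) ^+ 2 <= K ^+ 2 * ((r - s) ^+ 2) `^ a.
  have sub x y : 0 < x -> 0 < y -> y <= x ->
      (x `^ a - y `^ a) ^+ 2 <= ((x - y) ^+ 2) `^ a.
    move=> x0 y0 yx.
    have h1 := @powR_subadditive R a (x - y) y a01 ltac:(lra) ltac:(lra).
    have h2 := @ge0_ler_powR R a (ltW a0) y x.
    rewrite !nnegrE subrK in h1 h2.
    have {}h2 := h2 (ltW y0) (ltW x0) yx.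
    rewrite -sqrE; last lra.
    by rewrite ler_sqr ?nnegrE; lra.
  have h : (r `^ a - s `^ a) ^+ 2 <= ((r - s) ^+ 2) `^ a.
    have [rs|sr] := leP s r; first exact: sub.
    by rewrite -sqrrN opprB -[(r - s) ^+ 2]sqrrN opprB sub// ltW.
  apply: (le_trans h); rewrite ler_peMl ?powR_ge0//.
  by rewrite expr_ge1 ?powR_ge0.
have hi : (r `^ a + s `^ a) ^+ 2 <= K ^+ 2 * ((r + s) ^+ 2) `^ a.
  rewrite -sqrE; last lra.
  rewrite -exprMn ler_sqr ?nnegrE ?addr_ge0 ?mulr_ge0 ?powR_ge0//.
  by rewrite powR_sum_le//; lra.
rewrite exprMn (sqrE D)// DE.
have h := @powR_concave R a t ((r - s) ^+ 2) ((r + s) ^+ 2) a01 t01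
  (sqr_ge0 _) (sqr_ge0 _).
apply: (@le_trans _ _ (K ^+ 2 * (t * ((r - s) ^+ 2) `^ a +
                             (1 - t) * ((r + s) ^+ 2) `^ a))).
  rewrite mulrDr [K ^+ 2 * (t * _)]mulrCA [K ^+ 2 * ((1 - t) * _)]mulrCA.
  by have /andP[t0 t1] := t01; rewrite lerD// ler_wpM2l// subr_ge0.
by rewrite ler_wpM2l// sqr_ge0.
Qed.

(** The natural bound has max(|z|, |w|) in place of |z| + |z - w|; the larger sum
    has an L_p-norm that Minkowski's inequality controls. *)
Lemma cmazur_lipschitz b z w : 1 <= b ->
  `|cmazur b z - cmazur b w| <=
    b * `|z - w| * (`|z| + `|z - w|) `^ (b - 1).
Proof.
move=> b1; have c0 : 0 <= b - 1 by lra.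
have main (u v : Rcomplex R) (m : R) : `|v| <= `|u| -> `|u| <= m ->
    `|cmazur b u - cmazur b v| <= b * `|u - v| * m `^ (b - 1).
  move=> vu um.
  apply: (@le_trans _ _ (b * `|u - v| * `|u| `^ (b - 1))); last first.
    rewrite ler_wpM2l ?mulr_ge0//; first lra.
    by apply: ge0_ler_powR; rewrite ?nnegrE//; apply: le_trans um.
  (* Moving the point and moving the scalar factor contribute the parts 1 and
     b - 1 of the Lipschitz constant b. *)
  have -> : cmazur b u - cmazur b v = `|u| `^ (b - 1) *: (u - v) +
      (`|u| `^ (b - 1) - `|v| `^ (b - 1)) *: v.
    by rewrite !cmazurE scalerBr scalerBl addrA subrK.
  apply: (le_trans (ler_normD _ _)).
  rewrite !Rcomplex_normZ ger0_norm ?powR_ge0// ger0_norm; last first.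
    by rewrite subr_ge0 ge0_ler_powR ?nnegrE.
  have -> : b * `|u - v| * `|u| `^ (b - 1) =
    `|u| `^ (b - 1) * `|u - v| + (b - 1) * `|u - v| * `|u| `^ (b - 1) by ring.
  rewrite lerD2l.
  have [->|v0] := eqVneq v 0; first by rewrite normr0 mulr0 !mulr_ge0// powR_ge0.
  have s0 : 0 < `|v| by rewrite normr_gt0.
  have r0 : 0 < `|u| by rewrite (lt_le_trans s0).
  have h := powR_diff_le c0 r0 s0.
  have := ler_wpM2r (ltW s0) h.
  have -> : (b - 1) * (`|u| - `|v|) * (`|u| `^ (b - 1) / `|v|) * `|v| =
     (b - 1) * `|u| `^ (b - 1) * (`|u| - `|v|) by field; lra.
  move=> /le_trans; apply.
  rewrite [leRHS]mulrAC ler_wpM2l ?mulr_ge0 ?powR_ge0//.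
  by apply: le_trans (ler_dist_dist _ _); rewrite ler_norm.
have [wz|/ltW zw] := leP `|w| `|z|; first by apply: main; rewrite // lerDl.
rewrite distrC [in leRHS]distrC; apply: main => //.
by rewrite -[leLHS]/(`|w|) -{1}(subrK z w) addrC ler_normD.
Qed.

Lemma cmazur_comp a b z : 0 < a -> 0 < b ->
  cmazur b (cmazur a z) = cmazur (a * b) z.
Proof.
move=> a0 b0; rewrite [LHS]cmazurE norm_cmazur// !cmazurE scalerA.
have [->|z0] := eqVneq z 0; first by rewrite !scaler0.
congr (_ *: _); rewrite -powRrM -powRD; last by rewrite normr_eq0 z0 implybT.
congr (_ `^ _); ring.
Qed.

Lemma cmazur1 z : cmazur 1 z = z.
Proof. by rewrite cmazurE subrr powRr0 scale1r. Qed.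

End pointwise.

(** * Norms of nonnegative functions *)

Section norm_estimates.
Set Implicit Arguments.
Unset Strict Implicit.
Context d (T : measurableType d) (R : realType) (mu : {measure set T -> \bar R}).
Implicit Types (p q : R) (h : T -> R).

Lemma ge0_LnormE p h : 0 < p -> (forall x, 0 <= h x) ->
  Lnorm mu p%:E (EFin \o h) = ((\int[mu]_x (h x `^ p)%:E) `^ p^-1)%E.
Proof.
move=> p0 h0; rewrite unlock; congr poweR; apply: eq_integral => x _ /=.
by rewrite ger0_norm.
Qed.

Lemma ge0_le_Lnorm p h h' : 0 < p ->
  measurable_fun setT h -> measurable_fun setT h' ->
  (forall x, 0 <= h x) -> (forall x, h x <= h' x) ->
  (Lnorm mu p%:E (EFin \o h) <= Lnorm mu p%:E (EFin \o h'))%E.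
Proof.
move=> p0 mh mh' h0 hh'; have h'0 x : 0 <= h' x by apply: le_trans (hh' x).
have mpow (k : T -> R) : measurable_fun setT k ->
      measurable_fun setT (fun x => (k x `^ p)%:E).
  by move=> mk; apply/measurable_EFinP; exact: (measurableT_comp (measurable_powR p)).
rewrite !ge0_LnormE//; apply: gt0_ler_poweR.
- by rewrite invr_ge0 ltW.
- by rewrite in_itv/= leey andbT integral_ge0// => x _; rewrite lee_fin powR_ge0.
- by rewrite in_itv/= leey andbT integral_ge0// => x _; rewrite lee_fin powR_ge0.
apply: ge0_le_integral => //; try exact: mpow.
- by move=> x _; rewrite lee_fin powR_ge0.
- by move=> x _; rewrite lee_fin ge0_ler_powR ?nnegrE// ltW.
Qed.

Lemma ge0_LnormZ p k h : 0 < p -> 0 <= k -> measurable_fun setT h ->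
  (forall x, 0 <= h x) ->
  Lnorm mu p%:E (EFin \o (fun x => k * h x)) =
  (k%:E * Lnorm mu p%:E (EFin \o h))%E.
Proof.
move=> p0 k0 mh h0; rewrite !ge0_LnormE//; last by move=> x; rewrite mulr_ge0.
under eq_integral do rewrite powRM// EFinM.
have mhp : measurable_fun setT (fun x => (h x `^ p)%:E).
  by apply/measurable_EFinP; exact: (measurableT_comp (measurable_powR p)).
rewrite ge0_integralZl ?lee_fin ?powR_ge0//; last first.
  by move=> x _; rewrite lee_fin powR_ge0.
rewrite poweRM ?lee_fin ?powR_ge0//; last first.
  by apply: integral_ge0 => x _; rewrite lee_fin powR_ge0.
by rewrite poweR_EFin -powRrM mulfV ?gt_eqF// powRr1.
Qed.

Lemma ge0_Lnorm_powR p q h : 0 < p -> 0 < q -> (forall x, 0 <= h x) ->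
  Lnorm mu q%:E (EFin \o (fun x => h x `^ (p / q))) =
  (Lnorm mu p%:E (EFin \o h) `^ (p / q))%E.
Proof.
move=> p0 q0 h0; rewrite !ge0_LnormE//; last by move=> x; rewrite powR_ge0.
rewrite -poweRrM mulrA mulVf ?gt_eqF// mul1r; congr poweR.
by apply: eq_integral => x _; rewrite -powRrM divfK ?gt_eqF.
Qed.

(** Hoelder's inequality for h^q and k^(p-q) with exponents p/q and p/(p-q).
    When p = q the second exponent is infinite, but then k^(p/q-1) = 1. *)
Lemma Lnorm_mul_powR_le p q h (k : T -> R) : 0 < q -> q <= p ->
  measurable_fun setT h -> measurable_fun setT k ->
  (forall x, 0 <= h x) -> (forall x, 0 <= k x) ->
  (Lnorm mu q%:E (EFin \o (fun x => (h x * k x `^ (p / q - 1))%R)) <=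
   Lnorm mu p%:E (EFin \o h) * Lnorm mu p%:E (EFin \o k) `^ (p / q - 1))%E.
Proof.
move=> q0; rewrite le_eqVlt => /predU1P[<-|qp] mh mk h0 k0.
  rewrite divff ?gt_eqF// subrr poweRe0 mule1.
  by under eq_Lnorm do rewrite /= powRr0 mulr1.
have p0 : 0 < p by exact: lt_trans qp.
have pq0 : 0 < p - q by rewrite subr_gt0.
have mp (r : R) (f : T -> R) : measurable_fun setT f -> measurable_fun setT (fun x : T => f x `^ r : R).
  by move=> mf; exact: (measurableT_comp (measurable_powR r)).
rewrite [leLHS]ge0_LnormE//; last by move=> x; rewrite mulr_ge0 ?powR_ge0.
have -> : (\int[mu]_x ((h x * k x `^ (p / q - 1)) `^ q)%:E =
   Lnorm mu 1 (EFin \o ((fun x => h x `^ q) \* (fun x => k x `^ (p - q)))%R))%E.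
  rewrite Lnorm1; apply: eq_integral => x _ /=.
  rewrite ger0_norm ?mulr_ge0 ?powR_ge0// powRM ?powR_ge0// -powRrM.
  by rewrite mulrBl divfK ?gt_eqF// mul1r.
have conj : (p / q)^-1 + (p / (p - q))^-1 = 1 by field; lra.
have := hoelder mu (mp q _ mh) (mp (p - q) _ mk) (divr_gt0 p0 q0) (divr_gt0 p0 pq0) conj.
move=> H.
have iq0 : 0 <= q^-1 by rewrite invr_ge0 ltW.
have := gt0_ler_poweR iq0 _ _ H.
rewrite !in_itv/= !leey !andbT Lnorm_ge0 mule_ge0 ?Lnorm_ge0// => /(_ isT isT).
move=> /le_trans; apply.
rewrite poweRM ?Lnorm_ge0//.
have E (r : R) (f : T -> R) : 0 < r -> (forall x, 0 <= f x) ->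
    Lnorm mu (p / r)%:E (EFin \o (fun x => f x `^ r)) =
    (Lnorm mu p%:E (EFin \o f) `^ r)%E.
  move=> r0 f0; rewrite [in RHS](_ : r = p / (p / r)); last by field; lra.
  rewrite -ge0_Lnorm_powR ?divr_gt0//; congr Lnorm; apply/funext => x /=.
  by congr (_ `^ _)%:E; field; lra.
rewrite !E// -!poweRrM mulfV ?gt_eqF// poweRe1 ?Lnorm_ge0//.
by rewrite mulrBl mulfV ?gt_eqF.
Qed.

End norm_estimates.

(** * Estimates for the Mazur map on functions *)

Section mazur_estimates.
Set Implicit Arguments.
Unset Strict Implicit.
Context d (T : measurableType d) (R : realType) (mu : {measure set T -> \bar R}).
Implicit Types (p q : R) (f g : T -> Rcomplex R).

Lemma cmeasurableZ (k : R) f :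
  cmeasurable f -> cmeasurable (fun x => k *: f x).
Proof.
move=> [mr mi]; split.
  rewrite (_ : (fun x => _) = (fun x => k * complex.Re (f x))).
    by apply: measurable_funM => //; exact: measurable_cst.
  by apply/funext => x; case: (f x).
rewrite (_ : (fun x => _) = (fun x => k * complex.Im (f x))).
  by apply: measurable_funM => //; exact: measurable_cst.
by apply/funext => x; case: (f x).
Qed.

Lemma cLnormZ p (k : R) f : 0 < p -> cmeasurable f ->
  cLnorm mu p (fun x => k *: f x) = (`|k|%:E * cLnorm mu p f)%E.
Proof.
move=> p0 mf; rewrite /cLnorm -ge0_LnormZ//; last exact: cmeasurable_norm.
by apply: eq_Lnorm => x /=; rewrite Rcomplex_normZ.
Qed.

Lemma cLnorm_cmazur_hoelder p q f g : 1 <= p -> p <= q ->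
  cmeasurable f -> cmeasurable g ->
  (cLnorm mu q ((fun x => cmazur (p / q) (f x)) - (fun x => cmazur (p / q) (g x)))%R <=
   (2 `^ (1 - p / q))%:E * cLnorm mu p (f - g)%R `^ (p / q))%E.
Proof.
move=> p1 pq mf mg.
have p0 : 0 < p by exact: lt_le_trans p1.
have q0 : 0 < q by exact: lt_le_trans pq.
have mfg : measurable_fun setT (fun x => `|(f - g) x| : R).
  exact/cmeasurable_norm/cmeasurableD/cmeasurableN.
have mh : measurable_fun setT (fun x => `|(f - g) x| `^ (p / q) : R).
  exact: (measurableT_comp (measurable_powR (p / q)) mfg).
rewrite /cLnorm -ge0_Lnorm_powR// -ge0_LnormZ ?powR_ge0//.
apply: ge0_le_Lnorm => //.
- apply: cmeasurable_norm; apply: cmeasurableD; last apply: cmeasurableN;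
    exact: cmeasurable_cmazur.
- by apply: measurable_funM => //; exact: measurable_cst.
- move=> x; apply: cmazur_hoelder.
  by rewrite divr_gt0//= ler_pdivrMr// mul1r.
Qed.

(** The second factor stays close to the norm of [f] to the power p/q - 1 when
    [g] is close to [f], so for neighbouring functions of norm at most 1 the
    Lipschitz constant is close to p/q. *)
Lemma cLnorm_cmazur_local_lipschitz p q f g : 1 <= q -> q <= p ->
  cmeasurable f -> cmeasurable g ->
  (cLnorm mu q ((fun x => cmazur (p / q) (f x)) - (fun x => cmazur (p / q) (g x)))%R <=
   (p / q)%:E * (cLnorm mu p (f - g)%R *
     (cLnorm mu p f + cLnorm mu p (f - g)%R) `^ (p / q - 1)))%E.
Proof.
move=> q1 qp mf mg.
have q0 : 0 < q by exact: lt_le_trans q1.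
have p1 : 1 <= p by exact: le_trans qp.
have p0 : 0 < p by exact: lt_le_trans qp.
have b1 : 1 <= p / q by rewrite ler_pdivlMr// mul1r.
pose h x : R := `|(f - g) x|; pose k x : R := `|f x| + h x.
have mh : measurable_fun setT h.
  exact/cmeasurable_norm/cmeasurableD/cmeasurableN.
have mk : measurable_fun setT k.
  by apply: measurable_funD => //; exact: cmeasurable_norm.
have h0 x : 0 <= h x by exact: normr_ge0.
have k0 x : 0 <= k x by rewrite addr_ge0.
have mhk : measurable_fun setT (fun x => h x * k x `^ (p / q - 1)).
  apply: measurable_funM => //.
  exact: (measurableT_comp (measurable_powR (p / q - 1)) mk).
have b0 : 0 <= p / q by rewrite ltW// divr_gt0.
apply: (@le_trans _ _ (Lnorm mu q%:E (EFin \o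
    (fun x => p / q * (h x * k x `^ (p / q - 1)))))).
  apply: ge0_le_Lnorm => //.
  - apply: cmeasurable_norm; apply: cmeasurableD; last apply: cmeasurableN;
    exact: cmeasurable_cmazur.
  - by apply: measurable_funM => //; exact: measurable_cst.
  - by move=> x; rewrite mulrA; exact: cmazur_lipschitz.
rewrite ge0_LnormZ//; last by move=> x; rewrite mulr_ge0 ?powR_ge0.
rewrite lee_wpmul2l ?lee_fin//.
apply: (le_trans (Lnorm_mul_powR_le mu q0 qp mh mk h0 k0)).
rewrite lee_wpmul2l ?Lnorm_ge0//.
apply: gt0_ler_poweR; first by rewrite subr_ge0.
- by rewrite in_itv/= leey andbT Lnorm_ge0.
- by rewrite in_itv/= leey andbT adde_ge0// Lnorm_ge0.
apply: minkowski_EFin => //; exact: cmeasurable_norm.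
Qed.

(** The segment from [g] to [f] stays in the unit ball.  Cutting it into n pieces
    of length D/n, where D is the distance of [f] and [g], and applying the
    local estimate to each piece gives the bound b D (1 + D/n)^(b-1) with
    b = p/q; then n tends to infinity. *)
Lemma cLnorm_cmazur_lipschitz p q f g : 1 <= q -> q <= p ->
  cmeasurable f -> cmeasurable g ->
  (cLnorm mu p f <= 1)%E -> (cLnorm mu p g <= 1)%E ->
  (cLnorm mu q ((fun x => cmazur (p / q) (f x)) - (fun x => cmazur (p / q) (g x)))%R <=
   (p / q)%:E * cLnorm mu p (f - g)%R)%E.
Proof.
move=> q1 qp mf mg f1 g1.
have q0 : 0 < q by exact: lt_le_trans q1.
have p1 : 1 <= p by exact: le_trans qp.
have p0 : 0 < p by exact: lt_le_trans qp.
have b1 : 1 <= p / q by rewrite ler_pdivlMr// mul1r.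
set b := p / q in b1 *.
have b0 : 0 <= b by exact: le_trans b1.
have c0 : 0 <= b - 1 by rewrite subr_ge0.
have mfg : cmeasurable (f - g) by exact/cmeasurableD/cmeasurableN.
have : (cLnorm mu p (f - g)%R < +oo)%E.
  apply: le_lt_trans (cLnormD mu p1 mf (cmeasurableN mg)) _.
  by rewrite cLnormN lte_add_pinfty// (le_lt_trans f1, le_lt_trans g1) ?ltry.
have := cLnorm_ge0 mu p (f - g).
case E : (cLnorm mu p (f - g)%R) => [D| |]//; rewrite lee_fin => D0 _.
pose seg (s : R) := (fun x => (1 - s) *: g x) + (fun x => s *: f x) : T -> Rcomplex R.
pose M (s : R) := (fun x => cmazur b (seg s x)) : T -> Rcomplex R.
have mseg s : cmeasurable (seg s) by apply: cmeasurableD; exact: cmeasurableZ.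
have mM s : cmeasurable (M s) by exact: cmeasurable_cmazur.
have seg1 s : 0 <= s <= 1 -> (cLnorm mu p (seg s) <= 1)%E.
  move=> /andP[s0 s1]; apply: le_trans (cLnormD mu p1 _ _) _;
    [exact: cmeasurableZ..|].
  rewrite !cLnormZ// !ger0_norm ?subr_ge0//.
  apply: (@le_trans _ _ ((1 - s)%:E * 1 + s%:E * 1)%E).
    by apply: leeD; apply: lee_wpmul2l; rewrite ?lee_fin ?subr_ge0.
  by rewrite !mule1 -EFinD subrK.
have segB s t : 0 <= t - s -> cLnorm mu p (seg t - seg s) = ((t - s) * D)%:E.
  move=> ts; rewrite EFinM -E -{1}(ger0_norm ts) -cLnormZ//.
  congr cLnorm; apply/funext => x.
  rewrite -[LHS]/((1 - t) *: g x + t *: f x - ((1 - s) *: g x + s *: f x)).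
  rewrite -[RHS]/((t - s) *: (f x - g x)).
  have segE u : (1 - u) *: g x + u *: f x = g x + u *: (f x - g x).
    by rewrite scalerBl scale1r scalerBr addrA addrAC.
  by rewrite !segE opprD addrACA subrr add0r -scalerBl.
have bound n : (cLnorm mu q ((fun x => cmazur b (f x)) - (fun x => cmazur b (g x)))%R <=
    (b * D * (1 + D / n.+1%:R) `^ (b - 1))%:E)%E.
  set N : R := n.+1%:R; have N0 : 0 < N by rewrite ltr0n.
  have DN : 0 <= D / N by rewrite divr_ge0// ltW.
  pose B := b * (D / N * (1 + D / N) `^ (b - 1)).
  have step k : (k <= n)%N ->
      (cLnorm mu q (M (k.+1%:R / N) - M (k%:R / N))%R <= B%:E)%E.
    move=> kn; have := @cLnorm_cmazur_local_lipschitz p q _ _ q1 qp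
      (mseg (k.+1%:R / N)) (mseg (k%:R / N)).
    have kS : k.+1%:R / N - k%:R / N = N^-1 by rewrite -mulrBl -natrB// subSnn div1r.
    rewrite segB kS; last by rewrite invr_ge0 ltW.
    rewrite [N^-1 * D]mulrC => /le_trans; apply.
    rewrite /B !EFinM; apply: lee_wpmul2l; first by rewrite lee_fin.
    apply: lee_wpmul2l; first by rewrite lee_fin.
    rewrite -poweR_EFin; apply: gt0_ler_poweR; first by rewrite subr_ge0.
    - by rewrite in_itv/= leey andbT adde_ge0// cLnorm_ge0.
    - by rewrite in_itv/= leey andbT lee_fin addr_ge0.
    have kN : 0 <= k.+1%:R / N <= 1.
      apply/andP; split; first by rewrite divr_ge0// ltW.
      by rewrite ler_pdivrMr// mul1r ler_nat ltnS.
    by rewrite EFinD; apply: leeD => //; exact: seg1.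
  have tele k : (k <= n.+1)%N -> (cLnorm mu q (M (k%:R / N) - M 0)%R <= (k%:R * B)%:E)%E.
    elim: k => [_|k IH kn].
      by rewrite mul0r subrr cLnorm0// mul0r.
    rewrite -(subrK (M (k%:R / N)) (M (k.+1%:R / N))) -addrA.
    apply: le_trans (cLnormD mu q1 _ _) _.
    + by apply: cmeasurableD => //; exact: cmeasurableN.
    + by apply: cmeasurableD => //; exact: cmeasurableN.
    have -> : k.+1%:R * B = B + k%:R * B by rewrite -nat1r mulrDl mul1r.
    by rewrite EFinD leeD// ?step// IH// ltnW.
  have := tele n.+1 (leqnn _).
  rewrite divff ?gt_eqF//.
  have -> : M 1 = (fun x => cmazur b (f x)).
    apply/funext => x; congr cmazur.
    by rewrite -[LHS]/((1 - 1) *: g x + 1 *: f x) subrr scale0r add0r scale1r.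
  have -> : M 0 = (fun x => cmazur b (g x)).
    apply/funext => x; congr cmazur.
    by rewrite -[LHS]/((1 - 0) *: g x + 0 *: f x) subr0 scale0r addr0 scale1r.
  have -> : N * B = b * D * (1 + D / N) `^ (b - 1) by rewrite /B; field; lra.
  by [].
apply/lee_addgt0Pr => e e0; rewrite -EFinM -EFinD.
(* The bound for n pieces exceeds its limit b D by at most C/n. *)
pose C := b * D * ((b - 1) * D * (1 + D) `^ (b - 1)).
have C0 : 0 <= C.
  by rewrite /C mulr_ge0 ?(mulr_ge0 b0)// mulr_ge0 ?powR_ge0// mulr_ge0.
apply: (le_trans (bound (Num.truncn (C / e)))).
set n := Num.truncn _; set N : R := n.+1%:R.
have N0 : 0 < N by rewrite ltr0n.
have N1 : 1 <= N by rewrite ler1n.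
have CN : C / N <= e.
  by rewrite ler_pdivrMr// mulrC -ler_pdivrMr// ltW// truncnS_gt.
have DN : 0 <= D / N by rewrite divr_ge0// ltW.
rewrite lee_fin; apply: (@le_trans _ _ (b * D + C / N)); last by rewrite lerD2l.
have h1 : (1 + D / N) `^ (b - 1) - 1 <= (b - 1) * (D / N) * (1 + D / N) `^ (b - 1).
  have := @powR_diff_le R (b - 1) (1 + D / N) 1.
  rewrite powR1 addrAC subrr add0r divr1; apply => //.
  by rewrite ltr_pwDl.
have h2 : (1 + D / N) `^ (b - 1) <= (1 + D) `^ (b - 1).
  apply: ge0_ler_powR; rewrite ?nnegrE ?subr_ge0 ?addr_ge0//.
  by rewrite lerD2l ler_pdivrMr// ler_peMr.
have h3 : (b - 1) * (D / N) * (1 + D / N) `^ (b - 1) <=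
    (b - 1) * (D / N) * (1 + D) `^ (b - 1).
  by rewrite ler_wpM2l// mulr_ge0// subr_ge0.
have bD : 0 <= b * D by rewrite mulr_ge0.
have := ler_wpM2l bD (le_trans h1 h3).
rewrite (_ : b * D * ((b - 1) * (D / N) * (1 + D) `^ (b - 1)) = C / N); last first.
  by rewrite /C; field; lra.
by rewrite mulrBr mulr1 lerBlDl.
Qed.

End mazur_estimates.

(** * Moduli and the Mazur map on spheres *)

Section moduli_estimates.
Set Implicit Arguments.
Unset Strict Implicit.
Context {R : realType} {M N : metricType R}.
Implicit Types (f : M -> N) (c g : R).

Lemma upper_estimate_omega f c g : 0 <= c -> 0 <= g ->
  (forall x y, mdist (f x) (f y) <= c * mdist x y `^ g) ->
  upper_estimate (omega f) c g.
Proof.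
move=> c0 g0 fcg t /andP[t0 _]; apply: ge_ereal_sup => _ [[x y] /= xyt] <-.
rewrite lee_fin; apply: (le_trans (fcg x y)).
by rewrite ler_wpM2l// ge0_ler_powR// nnegrE mdist_ge0.
Qed.

Lemma lower_estimate_rho f c g : 0 <= c -> 0 <= g ->
  (forall x y, c * mdist x y `^ g <= mdist (f x) (f y)) ->
  lower_estimate (rho f) c g.
Proof.
move=> c0 g0 fcg t /andP[t0 _]; apply: le_ereal_inf_tmp => _ [[x y] /= xyt] <-.
rewrite lee_fin; apply: le_trans (fcg x y).
by rewrite ler_wpM2l// ge0_ler_powR// nnegrE ?mdist_ge0.
Qed.

Lemma upper_estimate_mdist f c g x y : upper_estimate (omega f) c g ->
  mdist x y <= 2 -> mdist (f x) (f y) <= c * mdist x y `^ g.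
Proof.
move=> + xy2 => /(_ (mdist x y)); rewrite mdist_ge0 xy2 => /(_ isT).
rewrite -lee_fin; apply: le_trans; apply: ereal_sup_ubound.
by exists (x, y) => /=.
Qed.

Lemma lower_estimate_mdist f c g x y : lower_estimate (rho f) c g ->
  mdist x y <= 2 -> c * mdist x y `^ g <= mdist (f x) (f y).
Proof.
move=> + xy2 => /(_ (mdist x y)); rewrite mdist_ge0 xy2 => /(_ isT).
rewrite -lee_fin => /le_trans; apply; apply: ereal_inf_lbound.
by exists (x, y) => /=.
Qed.

End moduli_estimates.

Lemma unit_sphere_mdist_le2 (R : realType) (X : normedZmodType R)
  (x y : unit_sphere X) : mdist x y <= 2.
Proof.
rewrite unit_sphere_mdistE (le_trans (ler_normB _ _))//.
by rewrite (eqP (valP x)) (eqP (valP y)).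
Qed.

Section mazur_sphere.
Set Implicit Arguments.
Unset Strict Implicit.
Context d (T : measurableType d) (R : realType) (mu : {measure set T -> \bar R}).
Implicit Types p q : R.
Local Open Scope quotient_scope.

Lemma unit_sphere_repr p (p1 : 1 <= p) (F : unit_sphere (cLspace mu p1)) :
  exists2 f : cLfunType mu p1,
    cLnorm mu p (val f) = 1%E & val F = \pi_(cLspace mu p1) f.
Proof.
exists (repr (val F)); last by rewrite reprK.
by rewrite -cLspace_normE reprK (eqP (valP F)).
Qed.

Lemma mdist_pi p (p1 : 1 <= p) (F G : unit_sphere (cLspace mu p1))
    (f g : cLfunType mu p1) :
  val F = \pi_(cLspace mu p1) f -> val G = \pi_(cLspace mu p1) g ->
  (mdist F G)%:E = cLnorm mu p (val f - val g)%R.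
Proof.
by move=> Ff Gg; rewrite unit_sphere_mdistE Ff Gg -raddfB cLspace_normE raddfB.
Qed.

Lemma val_mazur p q (p1 : 1 <= p) (q1 : 1 <= q)
    (F : unit_sphere (cLspace mu p1)) (f : cLfunType mu p1) :
  val F = \pi_(cLspace mu p1) f ->
  val (mazur mu p1 q1 F) = \pi_(cLspace mu q1) (mazurLfun q1 f).
Proof. by move=> Ff; rewrite /mazur SubK Ff mazurLspace_pi. Qed.

Lemma mazurK p q (p1 : 1 <= p) (q1 : 1 <= q) :
  cancel (mazur mu p1 q1) (mazur mu q1 p1).
Proof.
move=> F; apply: val_inj; have [f _ Ff] := unit_sphere_repr F.
rewrite (val_mazur _ (val_mazur _ Ff)) Ff; congr (\pi_(cLspace mu p1) _).
apply: val_inj; apply/funext => x; rewrite !val_mazurLfun.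
have p0 : 0 < p by exact: (lt_le_trans ltr01 p1).
have q0 : 0 < q by exact: (lt_le_trans ltr01 q1).
rewrite cmazur_comp ?divr_gt0// (_ : p / q * (q / p) = 1) ?cmazur1//.
by field; lra.
Qed.

Section upper.
Variables (p q : R) (p1 : 1 <= p) (q1 : 1 <= q).
Implicit Types F G : unit_sphere (cLspace mu p1).

Lemma mazur_hoelder F G : p <= q ->
  mdist (mazur mu p1 q1 F) (mazur mu p1 q1 G) <=
  2 `^ (1 - p / q) * mdist F G `^ (p / q).
Proof.
move=> pq; have [f _ Ff] := unit_sphere_repr F.
have [g _ Gg] := unit_sphere_repr G.
rewrite -lee_fin (mdist_pi (val_mazur q1 Ff) (val_mazur q1 Gg)) !val_mazurLfun.
rewrite EFinM -(poweR_EFin (mdist F G)) (mdist_pi Ff Gg).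
by apply: cLnorm_cmazur_hoelder => //; exact: (cLfunP _).1.
Qed.

Lemma mazur_lipschitz F G : q <= p ->
  mdist (mazur mu p1 q1 F) (mazur mu p1 q1 G) <= p / q * mdist F G.
Proof.
move=> pq; have [f f1 Ff] := unit_sphere_repr F.
have [g g1 Gg] := unit_sphere_repr G.
rewrite -lee_fin (mdist_pi (val_mazur q1 Ff) (val_mazur q1 Gg)) !val_mazurLfun.
rewrite EFinM (mdist_pi Ff Gg).
by apply: cLnorm_cmazur_lipschitz => //; rewrite ?f1 ?g1//; exact: (cLfunP _).1.
Qed.

End upper.

Section lower.
Variables (p q : R) (p1 : 1 <= p) (q1 : 1 <= q).
Implicit Types F G : unit_sphere (cLspace mu p1).

Let p0 : 0 < p. Proof. exact: (lt_le_trans ltr01 p1). Qed.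
Let q0 : 0 < q. Proof. exact: (lt_le_trans ltr01 q1). Qed.

(** The Hoelder estimate for the inverse map M_{q,p}, solved for the distance of
    the images. *)
Lemma mazur_hoelder_ge F G : q <= p ->
  2 `^ (1 - p / q) * mdist F G `^ (p / q) <=
  mdist (mazur mu p1 q1 F) (mazur mu p1 q1 G).
Proof.
move=> qp; have := mazur_hoelder p1 (mazur mu p1 q1 F) (mazur mu p1 q1 G) qp.
rewrite !mazurK; set D := mdist F G; set E := mdist (mazur _ _ _ _) _.
have D0 : 0 <= D by exact: mdist_ge0.
have E0 : 0 <= E by exact: mdist_ge0.
have b0 : 0 < p / q by rewrite divr_gt0.
move=> h; have := ge0_ler_powR (ltW b0) D0 _ h.
rewrite nnegrE mulr_ge0 ?powR_ge0// => /(_ isT).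
rewrite powRM ?powR_ge0// -!powRrM.
have qpK : q / p * (p / q) = 1.
  by rewrite mulrA divfK ?gt_eqF// divff// gt_eqF.
rewrite mulrBl mul1r qpK -[p / q - 1]opprB powRr1// powRN => {}h.
by rewrite -ler_pdivlMl ?powR_gt0.
Qed.

Lemma mazur_lipschitz_ge F G : p <= q ->
  p / q * mdist F G <= mdist (mazur mu p1 q1 F) (mazur mu p1 q1 G).
Proof.
move=> pq; have := mazur_lipschitz p1 (mazur mu p1 q1 F) (mazur mu p1 q1 G) pq.
rewrite !mazurK; set D := mdist F G; set E := mdist (mazur _ _ _ _) _ => h.
by rewrite -[p / q]invf_div ler_pdivrMl ?divr_gt0.
Qed.

End lower.
End mazur_sphere.

(** * Values of a non-atomic probability measure *)

Section non_atomic_values.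
Set Implicit Arguments.
Unset Strict Implicit.
Context d (T : measurableType d) (R : realType) (mu : probability T R).
Local Open Scope classical_set_scope.
Implicit Types (A B : set T) (r : R).

Let m A : R := fine (mu A).

Let muE A : measurable A -> mu A = (m A)%:E.
Proof. by move=> mA; rewrite fineK// fin_num_measure. Qed.

Let mU A B : measurable A -> measurable B -> A `&` B = set0 ->
  m (A `|` B) = m A + m B.
Proof.
move=> mA mB AB; apply: EFin_inj; rewrite EFinD -!muE//; last exact: measurableU.
exact: measureU.
Qed.

Let m_le A B : measurable A -> measurable B -> A `<=` B -> m A <= m B.
Proof.
by move=> mA mB AB; rewrite -lee_fin -!muE// le_measure// inE.
Qed.

(** A set of positive measure splits into two parts of positive measure, one of
    which has at most half of it; iterating makes the measure small. *)
Lemma non_atomic_small A (e : R) : non_atomic mu ->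
  measurable A -> (0 < mu A)%E -> 0 < e ->
  exists B, [/\ measurable B, B `<=` A, (0 < mu B)%E & (mu B <= e%:E)%E].
Proof.
move=> hmu mA A0 e0.
have half n : exists B, [/\ measurable B, B `<=` A, 0 < m B & m B <= 2^-1 ^+ n].
  elim: n => [|n [B [mB BA B0 Bn]]].
    exists A; split => //; first by rewrite -lte_fin -muE.
    by rewrite expr0 -lee_fin -muE// probability_le1.
  have muB0 : (0 < mu B)%E by rewrite muE.
  have [C [mC CB C0 CltB]] : exists C, [/\ measurable C, C `<=` B,
      (0 < mu C)%E & (mu C < mu B)%E] by exact: hmu.
  rewrite !muE// !lte_fin in C0 CltB.
  have mD : measurable (B `\` C) by exact: measurableD.
  have DE : m B = m C + m (B `\` C).
    by rewrite -mU// ?setDIK// setDUK.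
  rewrite exprS; have [h|h] := leP (m C) (m B / 2).
    by exists C; split => //; [exact: subset_trans BA|lra].
  by exists (B `\` C); split => //; [move=> x [Bx _]; exact: BA|lra|lra].
have [n ne] : exists n : nat, e^-1 < n%:R.
  by exists (Num.truncn e^-1).+1; exact: truncnS_gt.
have [B [mB BA B0 Bn]] := half n.
exists B; split => //; rewrite muE// ?lte_fin// lee_fin.
apply: (le_trans Bn); rewrite exprVn -[leRHS]invrK lef_pV2 ?posrE ?invr_gt0 ?exprn_gt0//.
apply: ltW; apply: (lt_le_trans ne); rewrite -natrX ler_nat.
by rewrite ltnW// ltn_expl.
Qed.

(** Build an increasing sequence of sets of measure at most [r], each step gaining
    at least half of the largest possible gain.  If the union had measure less
    than [r], then a small set of positive measure outside the union could be
    added at every step, so every gain would be bounded below, which is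
    impossible for bounded measures. *)
Lemma non_atomic_measure_eq r : non_atomic mu -> 0 <= r <= 1 ->
  exists2 A, measurable A & mu A = r%:E.
Proof.
move=> hmu /andP[r0 r1].
pose good A := measurable A /\ m A <= r.
have greedy E : exists F, good E ->
    [/\ good F, E `<=` F & forall G, good G -> E `<=` G ->
      m G - m E <= 2 * (m F - m E)].
  have [[mE Er]|nE] := pselect (good E); last by exists E.
  pose S := [set m G | G in [set G | good G /\ E `<=` G]].
  have SE : S (m E) by exists E => /=; split=> //; exact: subset_refl.
  have Sub : has_ubound S by exists r => _ [G [[_ Gr] _] <-].
  have upp G : good G -> E `<=` G -> m G <= sup S.
    by move=> gG EG; apply: ub_le_sup => //; exists G.
  have [sE|sE] := leP (sup S) (m E).
    exists E => _; split => // G gG EG.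
    by have := upp G gG EG; lra.
  have [|_ [F [gF EF] <-] Flt] := @sup_gt _ S ((sup S + m E) / 2) (ex_intro _ _ SE).
    lra.
  exists F => _; split => // G gG EG.
  by have := upp G gG EG; lra.
have [next nextP] := choice greedy.
pose E n := iter n next set0.
have gE n : good (E n).
  elim: n => [|n IH]; last by have [] := nextP _ IH.
  by split => /=; [exact: measurable0|rewrite /m measure0].
have ES n : E n `<=` E n.+1 by have [] := nextP _ (gE n).
have mE n : measurable (E n) by have [] := gE n.
have mbig : measurable (\bigcup_n E n) by exact: bigcup_measurable.
have ndE : {homo E : i j / (i <= j)%N >-> (i <= j)%O}.
  apply: homo_leq => // [A B C|n]; first exact: le_trans.
  by rewrite subsetEset.
have bigr : m (\bigcup_n E n) <= r.
  have cvE := nondecreasing_cvg_mu (mu := mu) mE mbig ndE.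
  rewrite -lee_fin -muE// -(cvg_lim _ cvE)//; apply: lime_le.
    by apply/cvg_ex; eexists; exact: cvE.
  by near=> n; rewrite /= muE// lee_fin; have [] := gE n.
exists (\bigcup_n E n) => //; rewrite muE//; congr EFin; apply/eqP.
rewrite eq_le bigr leNgt /=; apply/negP => ltr.
pose C := ~` \bigcup_n E n.
have mC : measurable C by exact: measurableC.
have C0 : (0 < mu C)%E.
  by rewrite probability_setC// muE// -EFinB lte_fin subr_gt0 (lt_le_trans ltr).
have gap : 0 < r - m (\bigcup_n E n) by rewrite subr_gt0.
have [B [mB BC B0 Br]] := non_atomic_small hmu mC C0 gap.
rewrite !muE// ?lte_fin ?lee_fin in B0 Br.
have step n : m B <= 2 * (m (E n.+1) - m (E n)).
  have dis : E n `&` B = set0.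
    by apply/seteqP; split => // x [Ex /BC]; apply; exists n.
  have EB : good (E n `|` B).
    split; first exact: measurableU.
    rewrite mU//; have : m (E n) <= m (\bigcup_n E n).
      by apply: m_le => //; exact: bigcup_sup.
    lra.
  have [_ _ /(_ _ EB (@subsetUl _ _ _))] := nextP _ (gE n).
  by rewrite mU// addrAC subrr add0r.
have grow n : n%:R * m B <= 2 * m (E n).
  elim: n => [|n IH]; first by rewrite mul0r mulr_ge0// fine_ge0.
  by rewrite -natr1 mulrDl mul1r; have := step n; lra.
have := truncnS_gt (2 / m B); set n := (Num.truncn _).+1.
rewrite ltr_pdivrMr// => h; have := grow n; have [_ Er] := gE n; lra.
Unshelve. all: by end_near.
Qed.

End non_atomic_values.

(** * Two-valued functions *)

Section two_valued.
Set Implicit Arguments.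
Unset Strict Implicit.
Context d (T : measurableType d) (R : realType) (mu : {measure set T -> \bar R}).
Variables (A : set T) (mA : measurable A).
Hypothesis muA : mu A = (2^-1)%:E.
Hypothesis muAC : mu (~` A)%classic = (2^-1)%:E.
Implicit Types a p q x y s : R.
Local Open Scope quotient_scope.

(** The affine form makes measurability immediate; [two_valuedE] reads off the
    two values. *)
Definition two_valued x y : T -> Rcomplex R :=
  fun t => Complex (y + (x - y) * \1_A t) 0.

(** The L_p-norm of [two_valued x y] when [A] has measure 1/2. *)
Definition mean_norm p x y : R := ((`|x| `^ p + `|y| `^ p) / 2) `^ p^-1.

(** The Mazur map on the real line. *)
Definition signed_powR a x : R := `|x| `^ (a - 1) * x.

Lemma two_valuedE x y t : two_valued x y t = Complex (if t \in A then x else y) 0.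
Proof.
rewrite /two_valued indicE; case: (t \in A); congr Complex.
  by rewrite mulr1 addrC subrK.
by rewrite mulr0 addr0.
Qed.

Lemma cmeasurable_two_valued x y : cmeasurable (two_valued x y).
Proof.
split; last exact: measurable_cst.
apply: measurable_funD; first exact: measurable_cst.
by apply: measurable_funM; [exact: measurable_cst|exact: measurable_indic].
Qed.

Lemma two_valuedB x y x' y' :
  two_valued x y - two_valued x' y' = two_valued (x - x') (y - y').
Proof.
apply/funext => t; rewrite -[LHS]/(two_valued x y t - two_valued x' y' t).
by rewrite !two_valuedE; case: ifP => _; apply/eqP; rewrite eq_complex /= subrr !eqxx.
Qed.

Lemma cmazur_two_valued a x y :
  (fun t => cmazur a (two_valued x y t)) =
  two_valued (signed_powR a x) (signed_powR a y).
Proof.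
apply/funext => t; rewrite !two_valuedE cmazurE Rcomplex_normE /=.
by rewrite expr0n /= addr0 sqrtr_sqr; case: ifP => _;
  apply/eqP; rewrite eq_complex /= mulr0 !eqxx.
Qed.

Lemma cLnorm_two_valued p x y : 0 < p ->
  cLnorm mu p (two_valued x y) = (mean_norm p x y)%:E.
Proof.
move=> p0; rewrite cLnormE -poweR_EFin; congr poweR.
under eq_integral => t _.
  rewrite (_ : (_ `^ p)%:E = ((`|x| `^ p)%:E * (\1_A t)%:E +
      (`|y| `^ p)%:E * (\1_(~` A)%classic t)%:E)%E); last first.
    rewrite two_valuedE Rcomplex_normE /= expr0n /= addr0 sqrtr_sqr.
    rewrite !indicE in_setC -!EFinM -EFinD.
    by case: (t \in A) => /=; rewrite mulr1 mulr0 ?addr0 ?add0r.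
  over.
have mAC : measurable (~` A)%classic by exact: measurableC.
have m1 (B : set T) : measurable B -> measurable_fun setT (fun t => (\1_B t : R)%:E).
  by move=> mB; apply/measurable_EFinP; exact: measurable_indic.
have pos (c : R) (B : set T) (t : T) : (0 <= (`|c| `^ p)%:E * (\1_B t : R)%:E)%E.
  by rewrite mule_ge0// lee_fin ?powR_ge0.
have mcB (c : R) (B : set T) : measurable B ->
    measurable_fun setT (fun t => ((`|c| `^ p)%:E * (\1_B t : R)%:E)%E).
  by move=> mB; apply: measurable_funeM; exact: m1.
rewrite ge0_integralD//; [|exact: mcB..].
rewrite !ge0_integralZl ?lee_fin ?powR_ge0//; [|exact: m1..].
rewrite !integral_indic// !setIT muA muAC -!EFinM -EFinD.
by congr EFin; rewrite mulrDl.
Qed.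

Lemma mean_normNN p x : 0 < p -> mean_norm p x (- x) = `|x|.
Proof.
move=> p0; rewrite /mean_norm normrN (_ : (_ + _) / 2 = `|x| `^ p); last lra.
by rewrite -powRrM mulfV ?gt_eqF// powRr1.
Qed.

Lemma mean_norm_diag p x : 0 < p -> mean_norm p x x = `|x|.
Proof. by move=> p0; rewrite -[RHS](mean_normNN x p0) /mean_norm normrN. Qed.

Lemma mean_normr0 p x : 0 < p -> mean_norm p x 0 = 2^-1 `^ p^-1 * `|x|.
Proof.
move=> p0; rewrite /mean_norm normr0 powR0 ?gt_eqF// addr0 mulrC powRM ?powR_ge0//.
by rewrite -powRrM mulfV ?gt_eqF// powRr1.
Qed.

Lemma ge0_signed_powR a x : 0 < a -> 0 <= x -> signed_powR a x = x `^ a.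
Proof.
by move=> a0 x0; rewrite /signed_powR ger0_norm// mulrC mulr_powRB1.
Qed.

Lemma signed_powRN a x : signed_powR a (- x) = - signed_powR a x.
Proof. by rewrite /signed_powR normrN mulrN. Qed.

Section pairs.
Variables (p q : R) (p1 : 1 <= p) (q1 : 1 <= q).

Let p0 : 0 < p. Proof. exact: (lt_le_trans ltr01 p1). Qed.
Let q0 : 0 < q. Proof. exact: (lt_le_trans ltr01 q1). Qed.
Let a0 : 0 < p / q. Proof. by rewrite divr_gt0. Qed.

Lemma exists_two_valued_pair x y x' y' :
  `|x| `^ p + `|y| `^ p = 2 -> `|x'| `^ p + `|y'| `^ p = 2 ->
  exists F G : unit_sphere (cLspace mu p1),
    mdist F G = mean_norm p (x - x') (y - y') /\
    mdist (mazur mu p1 q1 F) (mazur mu p1 q1 G) =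
    mean_norm q (signed_powR (p / q) x - signed_powR (p / q) x')
                (signed_powR (p / q) y - signed_powR (p / q) y').
Proof.
have point u v : `|u| `^ p + `|v| `^ p = 2 -> exists (F : unit_sphere (cLspace mu p1))
    (f : cLfunType mu p1), val F = \pi_(cLspace mu p1) f /\ val f = two_valued u v.
  move=> uv; have n1 : cLnorm mu p (two_valued u v) = 1%E.
    by rewrite cLnorm_two_valued// /mean_norm uv divff// powR1.
  have hf : two_valued u v \in cLfun mu p1.
    by apply/asboolP; split; [exact: cmeasurable_two_valued|rewrite n1 ltry].
  pose f : cLfunType mu p1 := Sub (two_valued u v) hf.
  have fE : val f = two_valued u v by exact: SubK.
  have hF : `|\pi_(cLspace mu p1) f| == 1.
    by rewrite -eqe cLspace_normE fE n1.
  exists (Sub (\pi_(cLspace mu p1) f) hF), f.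
  by split => //; exact: SubK.
move=> /point[F [f [Ff fE]]] /point[G [g [Gg gE]]]; exists F, G; split.
  by apply: EFin_inj; rewrite (mdist_pi Ff Gg) fE gE two_valuedB cLnorm_two_valued.
apply: EFin_inj; rewrite (mdist_pi (val_mazur q1 Ff) (val_mazur q1 Gg)).
by rewrite !val_mazurLfun fE gE !cmazur_two_valued two_valuedB cLnorm_two_valued.
Qed.

Lemma exists_antipodal_pair :
  exists F G : unit_sphere (cLspace mu p1),
    mdist F G = 2 /\ mdist (mazur mu p1 q1 F) (mazur mu p1 q1 G) = 2.
Proof.
have [||F [G [FG MFG]]] := @exists_two_valued_pair 1 1 (-1) (-1).
- by rewrite normr1 powR1.
- by rewrite normrN normr1 powR1.
have s1 : signed_powR (p / q) 1 = 1 by rewrite /signed_powR mulr1 normr1 powR1.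
have sN1 : signed_powR (p / q) (-1) = -1 by rewrite (signed_powRN _ 1) s1.
have two : 1 - -1 = 2 :> R by rewrite opprK.
exists F, G; rewrite FG MFG s1 sN1 two !mean_norm_diag//.
by rewrite ger0_norm.
Qed.

(** With u^p = 1 + e and v^p = 1 - e, the functions with values (u, v) and (v, u)
    have norm 1.  The ratio of u^a - v^a to u - v lies between a v^a/u and
    a u^a/v, and u, u^a <= 1 + e while v, v^a >= 1 - e because p, q >= 1. *)
Lemma exists_swap_pair (e : R) : 0 < e < 1 ->
  exists F G : unit_sphere (cLspace mu p1),
    let D := mdist F G in let E := mdist (mazur mu p1 q1 F) (mazur mu p1 q1 G) in
    [/\ 0 < D, D <= 2 * e,
        p / q * (1 - e) * D <= (1 + e) * E &
        (1 - e) * E <= p / q * (1 + e) * D].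
Proof.
move=> /andP[e0 e1].
pose u := (1 + e) `^ p^-1; pose v := (1 - e) `^ p^-1.
have ip1 : p^-1 <= 1 by rewrite invf_le1.
have iq1 : q^-1 <= 1 by rewrite invf_le1.
have u0 : 0 < u by rewrite powR_gt0; lra.
have v0 : 0 < v by rewrite powR_gt0; lra.
have vu : v < u.
  by apply: gt0_ltr_powR; rewrite ?invr_gt0 ?nnegrE//; lra.
have uE : u `^ p = 1 + e by rewrite -powRrM mulVf ?gt_eqF// powRr1; lra.
have vE : v `^ p = 1 - e by rewrite -powRrM mulVf ?gt_eqF// powRr1; lra.
have h1 : 1 <= 1 + e by rewrite lerDl ltW.
have h2 : 0 < 1 - e <= 1 by rewrite subr_gt0 e1 lerBlDr lerDl ltW.
have ue : u <= 1 + e := ler1_powR h1 ip1.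
have ve : 1 - e <= v := ger1_powR h2 ip1.
clearbody u v.
have uv2 : u - v <= 2 * e by lra.
have uaE : u `^ (p / q) = (1 + e) `^ q^-1 by rewrite powRrM uE.
have vaE : v `^ (p / q) = (1 - e) `^ q^-1 by rewrite powRrM vE.
have uae : u `^ (p / q) <= 1 + e by rewrite uaE; exact: (ler1_powR h1 iq1).
have vae : 1 - e <= v `^ (p / q).
  by rewrite vaE; exact: (ger1_powR h2 iq1).
have vaua : v `^ (p / q) < u `^ (p / q).
  by apply: gt0_ltr_powR => //; rewrite nnegrE ltW.
have [||F [G [FG MFG]]] := @exists_two_valued_pair u v v u.
- by rewrite (gtr0_norm u0) (gtr0_norm v0) uE vE; lra.
- by rewrite (gtr0_norm u0) (gtr0_norm v0) uE vE; lra.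
have su : signed_powR (p / q) u = u `^ (p / q) := ge0_signed_powR a0 (ltW u0).
have sv : signed_powR (p / q) v = v `^ (p / q) := ge0_signed_powR a0 (ltW v0).
have uv : 0 < u - v by rewrite subr_gt0.
have uva : 0 < u `^ (p / q) - v `^ (p / q) by rewrite subr_gt0.
exists F, G; rewrite FG MFG su sv -(opprB u) mean_normNN//.
rewrite -(opprB (u `^ _)) mean_normNN// (gtr0_norm uv) (gtr0_norm uva).
have uv0 : 0 <= p / q * (u - v) by rewrite mulr_ge0 ?ltW.
split; [exact: uv|exact: uv2|..].
- have h := powR_diff_le (ltW a0) v0 u0.
  have {}h : p / q * (u - v) * (v `^ (p / q) / u) <= u `^ (p / q) - v `^ (p / q).
    by rewrite -lerN2 opprB -mulNr -mulrN opprB.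
  apply: (@le_trans _ _ (u * (u `^ (p / q) - v `^ (p / q)))); last first.
    exact: ler_wpM2r (ltW uva) _ _ _.
  apply: le_trans (ler_wpM2l (ltW u0) h).
  rewrite [leRHS]mulrCA [u * (_ / u)]mulrC divfK ?gt_eqF//.
  by rewrite mulrAC ler_wpM2l.
- have h := powR_diff_le (ltW a0) u0 v0.
  apply: (@le_trans _ _ (v * (u `^ (p / q) - v `^ (p / q)))).
    exact: ler_wpM2r (ltW uva) _ _ _.
  apply: le_trans (ler_wpM2l (ltW v0) h) _.
  rewrite [leLHS]mulrCA [v * (_ / v)]mulrC divfK ?gt_eqF//.
  by rewrite [leRHS]mulrAC ler_wpM2l.
Qed.

(** The functions take the values s and -s on [A], and the same value r off [A],
    chosen to make the norm 1; they differ only on [A]. *)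
Lemma exists_flip_pair s : 0 < s <= 1 ->
  exists F G : unit_sphere (cLspace mu p1),
    mdist F G = 2^-1 `^ p^-1 * 2 * s /\
    mdist (mazur mu p1 q1 F) (mazur mu p1 q1 G) = 2^-1 `^ q^-1 * 2 * s `^ (p / q).
Proof.
move=> /andP[s0 s1]; pose r := (2 - s `^ p) `^ p^-1.
have r0 : 0 <= r by exact: powR_ge0.
have sp1 : s `^ p <= 1.
  by have := ge1r_powR (a := s) (r := p); rewrite s0 s1 => /(_ isT p1); lra.
have rE : `|r| `^ p = 2 - s `^ p.
  by rewrite ger0_norm// -powRrM mulVf ?gt_eqF// powRr1; lra.
clearbody r.
have [||F [G [FG MFG]]] := @exists_two_valued_pair s r (- s) r.
- by rewrite rE (gtr0_norm s0); lra.
- by rewrite rE normrN (gtr0_norm s0); lra.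
exists F, G; rewrite FG MFG (signed_powRN (p / q) s) (ge0_signed_powR a0 (ltW s0)) !opprK.
rewrite !subrr !mean_normr0// -!mulr2n !normrMn !ger0_norm ?powR_ge0 ?ltW//.
by split; rewrite [RHS]mulrAC mulr_natr mulrnAr.
Qed.

End pairs.
End two_valued.

(** * Sharpness *)

Section sharpness.
Set Implicit Arguments.
Unset Strict Implicit.
Context {R : realType}.
Implicit Types e s x y C K : R.

Lemma le_of_dilation x y :
  (forall e, 0 < e < 1 -> x * (1 - e) <= y * (1 + e)) -> x <= y.
Proof.
move=> xy; rewrite leNgt; apply/negP => yx.
(* If e (x + y) < x - y, the hypothesis fails at e.  The bounds w and z make
   (x - y)/(2z) such an e, whatever the sign of x + y. *)
pose w := `|x + y| + 1.
have w1 : 1 <= w by rewrite lerDr.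
pose z := x - y + w.
have z0 : 0 < z by rewrite /z; lra.
have e0 : 0 < (x - y) / (2 * z) by rewrite divr_gt0 ?subr_gt0// mulr_gt0.
have e1 : (x - y) / (2 * z) < 1 by rewrite ltr_pdivrMr ?mulr_gt0// /z; lra.
have := xy _ (introT andP (conj e0 e1)).
set e := _ / _ in e0 e1 * => h.
have ez : e * (2 * z) = x - y by rewrite /e divfK// gt_eqF// mulr_gt0.
have : x - y <= e * (x + y) by lra.
have : e * (x + y) <= e * z.
  rewrite ler_wpM2l ?(ltW e0)//; apply: (le_trans (ler_norm _)).
  by rewrite /z /w; lra.
have : 0 < e * z by rewrite mulr_gt0.
lra.
Qed.

(** The right-hand side tends to 0 with s; it is K/2 at s = (K/(2C))^(1/e). *)
Lemma not_le_powR K C e : 0 < K -> 0 < e ->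
  ~ (forall s, 0 < s <= 1 -> K <= C * s `^ e).
Proof.
move=> K0 e0 KC.
have C1 : K <= C by have := KC 1; rewrite powR1 mulr1; apply; rewrite ltr01 lexx.
have C0 : 0 < C by exact: lt_le_trans C1.
pose y := K / (2 * C).
have y0 : 0 < y by rewrite divr_gt0// mulr_gt0.
have y1 : y <= 1 by rewrite ler_pdivrMr ?mulr_gt0//; lra.
have s01 : 0 < y `^ e^-1 <= 1.
  rewrite powR_gt0//=.
  have -> : (1 : R) = 1 `^ e^-1 by rewrite powR1.
  by apply: ge0_ler_powR; rewrite ?nnegrE ?invr_ge0 ?(ltW e0) ?(ltW y0).
have yE : (y `^ e^-1) `^ e = y.
  by rewrite -powRrM mulVf ?gt_eqF// powRr1// ltW.
have CyE : C * y = K / 2 by rewrite /y; field; lra.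
have := KC _ s01; rewrite yE CyE; lra.
Qed.

End sharpness.

Section mazur_sharp.
Set Implicit Arguments.
Unset Strict Implicit.
Context d (T : measurableType d) (R : realType) (mu : probability T R).
Hypothesis hmu : non_atomic mu.
Variables (p q : R) (p1 : 1 <= p) (q1 : 1 <= q).

Let p0 : 0 < p. Proof. exact: (lt_le_trans ltr01 p1). Qed.
Let q0 : 0 < q. Proof. exact: (lt_le_trans ltr01 q1). Qed.
Let a0 : 0 < p / q. Proof. by rewrite divr_gt0. Qed.

Lemma exists_half : exists A : set T, [/\ measurable A, mu A = (2^-1)%:E
  & mu (~` A)%classic = (2^-1)%:E].
Proof.
have r01 : 0 <= (2^-1 : R) <= 1 by apply/andP; split; lra.
have [A mA muA] := non_atomic_measure_eq hmu r01.
exists A; split => //; rewrite probability_setC// muA -EFinB; congr EFin; lra.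
Qed.

Let M := mazur mu p1 q1.

Lemma mazur_swap_pair e : 0 < e < 1 ->
  exists F G : unit_sphere (cLspace mu p1),
    [/\ 0 < mdist F G, mdist F G <= 2 * e,
        p / q * (1 - e) * mdist F G <= (1 + e) * mdist (M F) (M G) &
        (1 - e) * mdist (M F) (M G) <= p / q * (1 + e) * mdist F G].
Proof.
have [A [mA muA muAC]] := exists_half.
exact: (exists_swap_pair mA muA muAC p1 q1).
Qed.

Lemma mazur_flip_pair : exists c k : R, [/\ 0 < c, 0 < k &
  forall s, 0 < s <= 1 -> exists F G : unit_sphere (cLspace mu p1),
    mdist F G = c * s /\ mdist (M F) (M G) = k * s `^ (p / q)].
Proof.
have [A [mA muA muAC]] := exists_half.
exists (2^-1 `^ p^-1 * 2), (2^-1 `^ q^-1 * 2).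
split; [by rewrite mulr_gt0// powR_gt0|by rewrite mulr_gt0// powR_gt0|].
exact: (exists_flip_pair mA muA muAC p1 q1).
Qed.

Lemma mazur_antipodal_pair : exists F G : unit_sphere (cLspace mu p1),
  mdist F G = 2 /\ mdist (M F) (M G) = 2.
Proof.
have [A [mA muA muAC]] := exists_half.
exact: (exists_antipodal_pair mA muA muAC p1 q1).
Qed.

(** Crude two-sided bounds, enough to exclude other exponents. *)
Lemma mazur_swap_ratio e (F G : unit_sphere (cLspace mu p1)) : 0 < e <= 2^-1 ->
  p / q * (1 - e) * mdist F G <= (1 + e) * mdist (M F) (M G) ->
  (1 - e) * mdist (M F) (M G) <= p / q * (1 + e) * mdist F G ->
  p / q / 3 * mdist F G <= mdist (M F) (M G) <= 3 * (p / q) * mdist F G.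
Proof.
move=> /andP[e0 e1].
have : 0 <= mdist F G by exact: mdist_ge0.
have : 0 <= mdist (M F) (M G) by exact: mdist_ge0.
move: (mdist F G) (mdist (M F) (M G)) (p / q) a0 => D E a ap E0 D0 lo hi.
have aD : 0 <= a * D by rewrite mulr_ge0// ltW.
by apply/andP; split; nra.
Qed.

(** The swapped pairs with e -> 0 give both the constant and the exponent. *)
Lemma omega_mazur_lipschitz_sharp : q <= p ->
  sharp_upper_estimate (omega M) (p / q) 1.
Proof.
move=> qp; split.
- apply: upper_estimate_omega => //; first exact: ltW.
  by move=> F G; rewrite powRr1 ?mdist_ge0//; exact: mazur_lipschitz.
- move=> c hc; apply: le_of_dilation => e e01.
  have [F [G [D0 _ lo _]]] := mazur_swap_pair e01.
  have /andP[e0 _] := e01.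
  have := upper_estimate_mdist hc (unit_sphere_mdist_le2 F G).
  rewrite powRr1 ?mdist_ge0// => hE.
  rewrite -(ler_pM2r D0); apply: (le_trans lo).
  by rewrite [leRHS]mulrAC mulrC ler_wpM2r// addr_ge0// ltW.
- move=> g c g1 hc.
  apply: (@not_le_powR _ (p / q / 3) `|c| (g - 1)); rewrite ?subr_gt0 ?divr_gt0//.
  move=> s /andP[s0 s1].
  have e01 : 0 < s / 2 < 1 by apply/andP; split; lra.
  have e12 : 0 < s / 2 <= 2^-1 by apply/andP; split; lra.
  have [F [G [D0 Ds lo hi]]] := mazur_swap_pair e01.
  have /andP[{}lo _] := mazur_swap_ratio e12 lo hi.
  have hE := upper_estimate_mdist hc (unit_sphere_mdist_le2 F G).
  rewrite mulrCA divff// mulr1 in Ds.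
  rewrite -(ler_pM2r D0); apply: (le_trans (le_trans lo hE)).
  rewrite -(mulr_powRB1 (ltW D0)); last by rewrite (lt_trans ltr01).
  rewrite [mdist F G * _]mulrC mulrA ler_wpM2r ?(ltW D0)//.
  apply: (@le_trans _ _ (`|c| * mdist F G `^ (g - 1))).
    by rewrite ler_wpM2r ?powR_ge0// ler_norm.
  rewrite ler_wpM2l// ge0_ler_powR ?nnegrE ?(ltW D0) ?(ltW s0)//.
  by rewrite subr_ge0 ltW.
Qed.

Lemma rho_mazur_lipschitz_sharp : p <= q ->
  sharp_lower_estimate (rho M) (p / q) 1.
Proof.
move=> pq; split.
- apply: lower_estimate_rho => //; first exact: ltW.
  by move=> F G; rewrite powRr1 ?mdist_ge0//; exact: mazur_lipschitz_ge.
- move=> c hc; apply: le_of_dilation => e e01.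
  have [F [G [D0 _ _ hi]]] := mazur_swap_pair e01.
  have /andP[_ e1] := e01.
  have := lower_estimate_mdist hc (unit_sphere_mdist_le2 F G).
  rewrite powRr1 ?mdist_ge0// => hE.
  rewrite -(ler_pM2r D0); apply: le_trans hi.
  by rewrite mulrAC mulrC ler_wpM2l// subr_ge0 ltW.
- move=> g c g1 c0 hc.
  apply: (@not_le_powR _ c (3 * (p / q)) (1 - g)); rewrite ?subr_gt0//.
  move=> s /andP[s0 s1].
  have e01 : 0 < s / 2 < 1 by apply/andP; split; lra.
  have e12 : 0 < s / 2 <= 2^-1 by apply/andP; split; lra.
  have [F [G [D0 Ds lo hi]]] := mazur_swap_pair e01.
  have /andP[_ {}hi] := mazur_swap_ratio e12 lo hi.
  have hE := lower_estimate_mdist hc (unit_sphere_mdist_le2 F G).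
  rewrite mulrCA divff// mulr1 in Ds.
  have Dg : mdist F G = mdist F G `^ (1 - g) * mdist F G `^ g.
    by rewrite -powRD ?subrK ?powRr1 ?ltW// oner_eq0.
  rewrite -(ler_pM2r (powR_gt0 g D0)); apply: (le_trans (le_trans hE hi)).
  rewrite [in leLHS]Dg mulrA ler_wpM2r ?powR_ge0//.
  apply: ler_wpM2l; first by rewrite mulr_ge0// ltW.
  apply: ge0_ler_powR; rewrite ?nnegrE ?(ltW D0) ?(ltW s0)//.
  by rewrite subr_ge0 ltW.
Qed.

(** The antipodal pair gives the constant, the flipped pairs with s -> 0 the
    exponent. *)
Lemma omega_mazur_hoelder_sharp : p <= q ->
  sharp_upper_estimate (omega M) (2 `^ (1 - p / q)) (p / q).
Proof.
have two : 2 `^ (1 - p / q) * 2 `^ (p / q) = 2 :> R.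
  by rewrite -powRD ?subrK ?powRr1// oner_eq0.
move=> pq; split.
- apply: upper_estimate_omega; [exact: powR_ge0|exact: ltW|].
  by move=> F G; exact: mazur_hoelder.
- move=> c hc; have [F [G [FG MFG]]] := mazur_antipodal_pair.
  have := upper_estimate_mdist hc (unit_sphere_mdist_le2 F G).
  rewrite FG; rewrite -/M MFG -[leLHS]two ler_pM2r//; exact: powR_gt0.
- move=> g c ag hc; have [l [k [l0 k0 flip]]] := mazur_flip_pair.
  apply: (@not_le_powR _ k (c * l `^ g) (g - p / q)); rewrite ?subr_gt0//.
  move=> s s01; have [F [G [FG MFG]]] := flip s s01.
  have /andP[s0 s1] := s01.
  have := upper_estimate_mdist hc (unit_sphere_mdist_le2 F G).
  rewrite FG MFG powRM ?(ltW l0) ?(ltW s0)//.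
  rewrite powRB; last by rewrite (gt_eqF s0) implybT.
  by move=> h; rewrite mulrA ler_pdivlMr ?powR_gt0// -mulrA.
Qed.

Lemma rho_mazur_hoelder_sharp : q <= p ->
  sharp_lower_estimate (rho M) (2 `^ (1 - p / q)) (p / q).
Proof.
have two : 2 `^ (1 - p / q) * 2 `^ (p / q) = 2 :> R.
  by rewrite -powRD ?subrK ?powRr1// oner_eq0.
move=> qp; split.
- apply: lower_estimate_rho; [exact: powR_ge0|exact: ltW|].
  by move=> F G; exact: mazur_hoelder_ge.
- move=> c hc; have [F [G [FG MFG]]] := mazur_antipodal_pair.
  have := lower_estimate_mdist hc (unit_sphere_mdist_le2 F G).
  rewrite FG; rewrite -/M MFG -[leRHS]two ler_pM2r//; exact: powR_gt0.
- move=> g c ga c0 hc; have [l [k [l0 k0 flip]]] := mazur_flip_pair.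
  apply: (@not_le_powR _ (c * l `^ g) k (p / q - g)); rewrite ?subr_gt0//.
    by rewrite mulr_gt0 ?powR_gt0.
  move=> s s01; have [F [G [FG MFG]]] := flip s s01.
  have /andP[s0 s1] := s01.
  have := lower_estimate_mdist hc (unit_sphere_mdist_le2 F G).
  rewrite FG MFG powRM ?(ltW l0) ?(ltW s0)//.
  rewrite powRB; last by rewrite (gt_eqF s0) implybT.
  by move=> h; rewrite mulrA ler_pdivlMr ?powR_gt0// -mulrA.
Qed.

End mazur_sharp.

Theorem theorem4p3 (R : realType) (d : measure_display) (T : measurableType d)
    (mu : probability T R) (hmu : non_atomic mu)
    (p q : R) (hp : 1 <= p) (hq : 1 <= q) :
  (q < p ->
    sharp_upper_estimate (omega (mazur mu hp hq)) (p / q) 1 /\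
    sharp_lower_estimate (rho (mazur mu hp hq))
      (2 `^ (1 - p / q)) (p / q)) /\
  (p <= q ->
    sharp_upper_estimate (omega (mazur mu hp hq))
      (2 `^ (1 - p / q)) (p / q) /\
    sharp_lower_estimate (rho (mazur mu hp hq)) (p / q) 1).
Proof.
split=> pq; split.
- exact: (omega_mazur_lipschitz_sharp hmu hp hq (ltW pq)).
- exact: (rho_mazur_hoelder_sharp hmu hp hq (ltW pq)).
- exact: (omega_mazur_hoelder_sharp hmu hp hq pq).
- exact: (rho_mazur_lipschitz_sharp hmu hp hq pq).
Qed.
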